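(* Let $G$ be a DMG with node set $\mathcal I\cup\mathcal K$ that satisfies JCI Assumptions $\{1,2,3\}$. Let $P=\mathcal{P}_{\mathrm{FCI\text{-}JCI}}(\mathrm{IM}_\sigma(G))$ denote the complete DPAG output by the corresponding version of FCI-JCI. Let $i\neq j$ be two nodes in $P$. If $j\in\mathrm{sc}_G(i)$, then $i\circ\!\!-\!\!\circ j$ in $P$, and for all nodes $k\neq i,j$: $k\to i$ in $P$ iff $k\to j$ in $P$, and $k\leftrightarrow i$ in $P$ iff $k\leftrightarrow j$ in $P$, and $k\circ\!\!\to i$ in $P$ iff $k\circ\!\!\to j$ in $P$.
   Context: DMGs. A directed mixed graph (DMG) $G=\langle V,E,F\rangle$ has a finite node set $V$, directed edges $i\to j$ and bidirected edges $i\leftrightarrow j$ between distinct nodes; several edges between two nodes are allowed (at most one of each of $i\to j$, $i\leftarrow j$, $i\leftrightarrow j$). A walk is an alternating sequence of nodes and edges, each edge connecting consecutive nodes; a path is a walk containing each node at most once. $\mathrm{an}_G(j)$ is the set of nodes $i$ with a (possibly trivial) directed path $i\to\dots\to j$; $\mathrm{de}_G(i)=\{j:i\in\mathrm{an}_G(j)\}$; $\mathrm{sc}_G(i)=\mathrm{an}_G(i)\cap\mathrm{de}_G(i)$; $\mathrm{an}_G(I)=\bigcup_{i\in I}\mathrm{an}_G(i)$. A non-endpoint node on a walk is a collider if both adjacent walk edges have an arrowhead at it; other nodes on it are non-colliders. $\sigma$-separation. A walk is $\sigma$-blocked by $C\subseteq V$ if: its first or last node is in $C$; or it contains a collider not in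 $\mathrm{an}_G(C)$; or it contains a non-endpoint non-collider $k\in C$ with a directed walk edge $k\to l$ to a neighbouring node $l$ on the walk with $l\notin\mathrm{sc}_G(k)$. $A$ is $\sigma$-separated from $B$ by $C$ if all paths between nodes of $A$ and nodes of $B$ are $\sigma$-blocked by $C$. $\mathrm{IM}_\sigma(G)$ is the set of triples $\langle A,B,C\rangle$ of subsets of $V$ such that $A$ is $\sigma$-separated from $B$ by $C$. DPAG notation. Output graphs (DPAGs) have at most one edge between two distinct nodes, of types $\to,\leftarrow,\leftrightarrow,\circ\!\!\to,\leftarrow\!\!\circ,\circ\!\!-\!\!\circ$; $*$ stands for any edge mark. A path $v_0,\dots,v_n$ is possibly directed from $v_0$ to $v_n$ if each edge between $v_{m-1}$ and $v_m$ is $v_{m-1}\circ\!\!-\!\!\circ v_m$, $v_{m-1}\circ\!\!\to v_m$ or $v_{m-1}\to v_m$; it is uncovered if $v_{m-2},v_m$ are non-adjacent for $m=2,\dots,n$. JCI Assumptions. The node set is a disjoint union $V=\mathcal I\cup\mathcal K$ of system nodes $\mathcal I$ and context nodes $\mathcal K$. (1) Exogeneity: for all $k\in\mathcal K,i\in\mathcal I$: $i\to k\notin G$. (2) Randomization: for all $k\in\mathcal K,i\in\mathcal I$: $i\leftrightarrow k\notin G$. (3) Genericity: for all $k\neq k'\in\mathcal K$: $k\leftrightarrow k'\in G$ and $k\to k'\notin G$. FCI-JCI for JCI Assumptions $\{1,2,3\}$ (without selection bias). Given an independence model $I$ (set of triples of subsets of $V$): distinct $i,j$ are adjacent iff there is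 no $Z\subseteq V\setminus\{i,j\}$ with $\langle\{i\},\{j\},Z\rangle\in I$ (context nodes are always mutually adjacent); for non-adjacent $i,j$, $\mathrm{SepSet}(i,j)$ is one such $Z$ (chosen by a fixed rule). All edges start as $\circ\!\!-\!\!\circ$. R0: for every unshielded triple $\langle a,c,b\rangle$ ($a,c$ adjacent, $c,b$ adjacent, $a,b$ non-adjacent), orient $a\,*\!\!\to c\leftarrow\!\!*\,b$ iff $c\notin\mathrm{SepSet}(a,b)$. Background orientations: every edge between $k\in\mathcal K$ and $i\in\mathcal I$ is oriented $k\to i$, and all pairs $k\ne k'\in\mathcal K$ are oriented $k\leftrightarrow k'$. Then exhaustively R1–R4. R1: if $a\,*\!\!\to b\circ\!\!-\!\!*\,c$ with $a,c$ non-adjacent, orient $b\to c$. R2: if ($a\to b\,*\!\!\to c$ or $a\,*\!\!\to b\to c$) and $a\,*\!\!-\!\!\circ c$, orient $a\,*\!\!\to c$. R3: if $a\,*\!\!\to b\leftarrow\!\!*\,c$, $a\,*\!\!-\!\!\circ d\circ\!\!-\!\!*\,c$, $a,c$ non-adjacent and $d\,*\!\!-\!\!\circ b$, orient $d\,*\!\!\to b$. R4: if $\langle x,\dots,a,b,c\rangle$ is a discriminating path for $b$ (at least three edges, $x,c$ non-adjacent, every node strictly between $x$ and $b$ is a collider on the path and a parent of $c$) and $b\circ\!\!-\!\!*\,c$, orient $b\to c$ if $b\in\mathrm{SepSet}(x,c)$ and $a\leftrightarrow b\leftrightarrow c$ otherwise. Then exhaustively R8a, R9, R10. R8a: if $a\to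 b\to c$ and $a\circ\!\!\to c$, orient $a\to c$. R9: if $a\circ\!\!\to c$ and there is an uncovered possibly directed path $\langle a,b,\dots,c\rangle$ with $b,c$ non-adjacent, orient $a\to c$. R10: if $a\circ\!\!\to c$, $b\to c\leftarrow d$, and there are uncovered possibly directed paths $\langle a,m_1,\dots,b\rangle$ and $\langle a,m_2,\dots,d\rangle$ with $m_1,m_2$ distinct and non-adjacent, orient $a\to c$. *)

(* Defs.v *)
From Stdlib Require Import Relation_Operators.
From mathcomp Require Import all_boot.
From mathcomp Require Import boolp.

Set Implicit Arguments.
Unset Strict Implicit.
Unset Printing Implicit Defensive.

(** * Directed mixed graphs *)

(* The node set is the whole finite type [V]. *)
Record dmg (V : finType) := DMG {
  dir : rel V;                                   (* dir i j : i -> j  *)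
  bidir : rel V;                                 (* bidir i j : i <-> j *)
  dir_irrefl : irreflexive dir;
  bidir_irrefl : irreflexive bidir;
  bidir_sym : symmetric bidir
}.

Section DMGTheory.
Variables (V : finType) (G : dmg V).

Definition an (j : V) : {set V} := [set i | connect (dir G) i j].
Definition de (i : V) : {set V} := [set j | i \in an j].
Definition sc (i : V) : {set V} := an i :&: de i.
Definition anS (I : {set V}) : {set V} := \bigcup_(i in I) an i.

(* The type of a walk edge, read in the direction in which the walk is
   traversed: u -> v, u <- v, u <-> v. *)
Inductive edge_type := Fwd | Bwd | Bi.

Definition edge_in (u : V) (e : edge_type) (v : V) : bool :=
  match e with
  | Fwd => dir G u v
  | Bwd => dir G v u
  | Bi => bidir G u v
  end.

(* A walk is its first node followed by the successive (edge, node) pairs. *)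
Definition walk_data := (V * seq (edge_type * V))%type.

Fixpoint is_walk_from (u : V) (s : seq (edge_type * V)) : bool :=
  if s is (e, v) :: s' then edge_in u e v && is_walk_from v s' else true.

Definition is_walk (w : walk_data) : bool := is_walk_from w.1 w.2.

Definition wnodes (w : walk_data) : seq V := w.1 :: [seq x.2 | x <- w.2].
Definition wlength (w : walk_data) : nat := size w.2.
Definition wnode (w : walk_data) (m : nat) : V := nth w.1 (wnodes w) m.
(* [wedge w m] joins [wnode w m] and [wnode w m.+1], for m < wlength w. *)
Definition wedge (w : walk_data) (m : nat) : edge_type :=
  nth Fwd [seq x.1 | x <- w.2] m.
Definition wfirst (w : walk_data) : V := wnode w 0.
Definition wlast (w : walk_data) : V := wnode w (wlength w).

Definition is_path (w : walk_data) : bool := is_walk w && uniq (wnodes w).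

Definition head_right (e : edge_type) : bool := if e is Bwd then false else true.
Definition head_left (e : edge_type) : bool := if e is Fwd then false else true.

(* For a non-endpoint position, 0 < m < wlength w. *)
Definition collider_at (w : walk_data) (m : nat) : bool :=
  head_right (wedge w m.-1) && head_left (wedge w m).

Definition leaves_sc_at (w : walk_data) (m : nat) : Prop :=
     (wedge w m = Fwd /\ wnode w m.+1 \notin sc (wnode w m))
  \/ (wedge w m.-1 = Bwd /\ wnode w m.-1 \notin sc (wnode w m)).

Definition sigma_blocked (w : walk_data) (C : {set V}) : Prop :=
  [\/ wfirst w \in C \/ wlast w \in C,
      exists m, [/\ 0 < m < wlength w, collider_at w m
                  & wnode w m \notin anS C]
    | exists m, [/\ 0 < m < wlength w, ~~ collider_at w m,
                    wnode w m \in C & leaves_sc_at w m]].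

Definition sigma_sep (A B C : {set V}) : Prop :=
  forall w : walk_data, is_path w -> wfirst w \in A -> wlast w \in B ->
    sigma_blocked w C.

End DMGTheory.

Definition indep_model (V : finType) := {set {set V} * {set V} * {set V}}.

Definition IM_sigma (V : finType) (G : dmg V) : indep_model V :=
  [set t | `[< sigma_sep G t.1.1 t.1.2 t.2 >]].

(** * JCI assumptions *)

(* [K] is the set of context nodes; the system nodes are its complement. *)
Definition jci_exogeneity (V : finType) (G : dmg V) (K : {set V}) : Prop :=
  forall k i, k \in K -> i \in ~: K -> ~~ dir G i k.
Definition jci_randomization (V : finType) (G : dmg V) (K : {set V}) : Prop :=
  forall k i, k \in K -> i \in ~: K -> ~~ bidir G i k.
Definition jci_genericity (V : finType) (G : dmg V) (K : {set V}) : Prop :=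
  forall k k', k \in K -> k' \in K -> k != k' -> bidir G k k' /\ ~~ dir G k k'.

Definition jci123 (V : finType) (G : dmg V) (K : {set V}) : Prop :=
  [/\ jci_exogeneity G K, jci_randomization G K & jci_genericity G K].

(** * Partially oriented graphs *)

Inductive mark := Circle | Arrow | Tail.

(* [P (u, v)] is the mark at the [v]-end of the edge between [u] and [v], and
   [None] when [u] and [v] are not adjacent; so u -> v means
   [P (v, u) = Some Tail] and [P (u, v) = Some Arrow]. *)
Definition pgraph (V : finType) := {ffun V * V -> option mark}.

Section PGraph.
Variable V : finType.
Implicit Types (P : pgraph V) (u v : V).

Definition adj P u v : bool := isSome (P (u, v)).

(* Distinctness is part of "non-adjacent". *)
Definition nonadj P u v : bool := (u != v) && ~~ adj P u v.

Definition unshielded P a c b : bool := [&& adj P a c, adj P c b & nonadj P a b].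

Definition edge_marks P u mu mv v : Prop :=
  P (v, u) = Some mu /\ P (u, v) = Some mv.

Definition p_dir P u v : Prop := edge_marks P u Tail Arrow v.          (* u --> v *)
Definition p_bidir P u v : Prop := edge_marks P u Arrow Arrow v.       (* u <-> v *)
Definition p_circ_arrow P u v : Prop := edge_marks P u Circle Arrow v. (* u o-> v *)
Definition p_circ_circ P u v : Prop := edge_marks P u Circle Circle v. (* u o-o v *)

Definition star_arrow P u v : Prop := P (u, v) = Some Arrow.  (* u *-> v *)
Definition star_circ P u v : Prop := P (u, v) = Some Circle.  (* u *-o v *)

Definition set_mark P u v (m : mark) : pgraph V :=
  [ffun e => if e == (u, v) then Some m else P e].

Definition orient P u mu mv v : pgraph V := set_mark (set_mark P v u mu) u v mv.

Definition possibly_dir_edge P u v : bool :=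
  match P (v, u), P (u, v) with
  | Some Circle, Some Circle | Some Circle, Some Arrow | Some Tail, Some Arrow => true
  | _, _ => false
  end.

(* The node sequence of the path is [a :: p]; it ends in [c]. *)
Definition uncovered_possibly_dir P a (p : seq V) c : Prop :=
  [/\ uniq (a :: p), path (possibly_dir_edge P) a p, last a p = c
    & forall m, 2 <= m <= size p ->
        nonadj P (nth a (a :: p) (m - 2)) (nth a (a :: p) m)].

(* The node sequence of the path is x, q, a, b, c; the positions strictly
   between x and b are 1, ..., size q + 1. *)
Definition discriminating P x (q : seq V) a b c : Prop :=
  let p := q ++ [:: a; b; c] in
  let v := nth x (x :: p) in
  [/\ uniq (x :: p), path (adj P) x p, nonadj P x c
    & forall m, 0 < m <= (size q).+1 ->
        [/\ star_arrow P (v m.-1) (v m), star_arrow P (v m.+1) (v m)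
          & p_dir P (v m) c]].

End PGraph.

(** * FCI-JCI for JCI assumptions 1, 2, 3 *)

Section FCIJCI.
Variables (V : finType) (K : {set V}) (IM : indep_model V).

Definition separates (Z : {set V}) (i j : V) : bool :=
  (Z \subset ~: [set i; j]) && (([set i], [set j], Z) \in IM).

Definition fci_adjacent (i j : V) : bool :=
  (i != j) && (((i \in K) && (j \in K)) || ~~ [exists Z, separates Z i j]).

(* Separating sets are indexed by the unordered pair [set i; j]. *)
Definition valid_sepset (sepset : {set V} -> {set V}) : Prop :=
  forall i j, i != j -> ~~ fci_adjacent i j -> separates (sepset [set i; j]) i j.

Variable sepset : {set V} -> {set V}.

Definition fci_skeleton : pgraph V :=
  [ffun e => if fci_adjacent e.1 e.2 then Some Circle else None].

(* All unshielded triples are treated at once: the mark at c on the edge a -- c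
   becomes an arrowhead iff some unshielded triple <a, c, b> asks for it. *)
Definition fci_R0 (P : pgraph V) : pgraph V :=
  [ffun e =>
     if [exists b, unshielded P e.1 e.2 b && (e.2 \notin sepset [set e.1; b])]
     then Some Arrow else P e].

Definition fci_background (P : pgraph V) : pgraph V :=
  [ffun e => if adj P e.1 e.2 then
     match e.1 \in K, e.2 \in K with
     | true, true => Some Arrow
     | true, false => Some Arrow
     | false, true => Some Tail
     | false, false => P e
     end else None].

Inductive fci_step14 (P : pgraph V) : pgraph V -> Prop :=
| R1 a b c : star_arrow P a b -> star_circ P c b -> nonadj P a c ->
    fci_step14 P (orient P b Tail Arrow c)
| R2 a b c :
    (p_dir P a b /\ star_arrow P b c) \/ (star_arrow P a b /\ p_dir P b c) ->
    star_circ P a c ->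
    fci_step14 P (set_mark P a c Arrow)
| R3 a b c d : star_arrow P a b -> star_arrow P c b ->
    star_circ P a d -> star_circ P c d -> nonadj P a c -> star_circ P d b ->
    fci_step14 P (set_mark P d b Arrow)
| R4_in x q a b c : discriminating P x q a b c -> star_circ P c b ->
    b \in sepset [set x; c] ->
    fci_step14 P (orient P b Tail Arrow c)
| R4_out x q a b c : discriminating P x q a b c -> star_circ P c b ->
    b \notin sepset [set x; c] ->
    fci_step14 P (orient (orient P a Arrow Arrow b) b Arrow Arrow c).

Inductive fci_step810 (P : pgraph V) : pgraph V -> Prop :=
| R8a a b c : p_dir P a b -> p_dir P b c -> p_circ_arrow P a c ->
    fci_step810 P (orient P a Tail Arrow c)
| R9 a b p c : p_circ_arrow P a c ->
    uncovered_possibly_dir P a (b :: p) c -> nonadj P b c ->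
    fci_step810 P (orient P a Tail Arrow c)
| R10 a b c d m1 p1 m2 p2 : p_circ_arrow P a c -> p_dir P b c -> p_dir P d c ->
    uncovered_possibly_dir P a (m1 :: p1) b ->
    uncovered_possibly_dir P a (m2 :: p2) d ->
    nonadj P m1 m2 ->
    fci_step810 P (orient P a Tail Arrow c).

(* Every step of either system turns at least one circle into an arrowhead or a
   tail and creates none, so exhaustive application always terminates. *)
Definition exhaust (step : pgraph V -> pgraph V -> Prop) (P Q : pgraph V) : Prop :=
  clos_refl_trans _ step P Q /\ forall Q', ~ step Q Q'.

Definition fci_jci_run (P : pgraph V) : Prop :=
  exists2 P1, exhaust fci_step14 (fci_background (fci_R0 fci_skeleton)) P1
            & exhaust fci_step810 P1 P.

End FCIJCI.

(* [P] is an output of the algorithm, for some choice of separating sets and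
   some order in which the rules are applied. *)
Definition fci_jci_output (V : finType) (K : {set V}) (IM : indep_model V)
    (P : pgraph V) : Prop :=
  exists2 sepset, valid_sepset K IM sepset & fci_jci_run K IM sepset P.

(* Main.v *)
Require Import Defs.
From Stdlib Require Import Relation_Operators Operators_Properties.
From mathcomp Require Import all_boot.
From mathcomp Require Import boolp zify.

Set Implicit Arguments.
Unset Strict Implicit.
Unset Printing Implicit Defensive.

(** The marks of the output have an ancestral meaning: an arrowhead at [v] on an
    edge between [u] and [v] says that [v] is not an ancestor of [u], a tail at
    [v] says that it is. Two strongly connected nodes [i] and [j] are adjacent,
    and neither an arrowhead nor a tail (which faces an arrowhead) can be sound
    between them; so the edge keeps its two circles.

    The meaning is derived from an ancestral criterion for sigma-separation.
    Within the ancestors of [a], [b] and [Z], delete the directed edges that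
    leave a node of [Z] and its strongly connected component; then [a] and [b]
    are not separated by [Z] if they remain connected ([connected_not_sep]).
    Adjacency of [a] and [b] becomes: among their ancestors, both lie in or point
    into a common district, where a district is a class for bidirected edges
    and strong connectedness together ([adjacentP]). An arrowhead at [i] means
    that the link enters the district of [i], which contains [j]: hence a node
    adjacent to [i] through an arrowhead at [i] is adjacent to [j]
    ([inducing_sc]). The soundness of the rules follows ([step14_sound],
    [step810_sound]).

    For arrowheads, Zhang's lemma for the closure under R1-R4 is proved by
    induction along the run: if there is an arrowhead at [b] on the edge between
    [a] and [b], and a circle at [b] on the edge between [e] and [b], then there
    is an arrowhead at [e] on the edge between [a] and [e] ([step14_spread]).
    Applied to the circles between [i] and [j], it transports arrowheads at [i]
    to [j]; it also excludes an arrowhead at [k] on one of the edges to [i] and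
    [j] facing a circle at [k] on the other, as this would put an arrowhead
    between [i] and [j].

    For tails, a second induction along the two runs shows that a rule which
    puts a tail on the edge from [k] to [i] is applicable, in the terminal
    graph, to [k] and [j] ([step14_tails], [step810_tails]). The delicate case
    is R9, where the uncovered path ending in [i] is redirected to [j]
    ([uncovered_sc_end]). *)

(** * Ancestors *)
Section Ancestors.
Variables (V : finType) (G : dmg V).
Implicit Types (u v w a b c : V) (A B Z : {set V}).

Lemma an_refl u : u \in an G u.
Proof. by rewrite inE connect0. Qed.

Lemma an_trans v u w : u \in an G v -> v \in an G w -> u \in an G w.
Proof. by rewrite !inE; apply: connect_trans. Qed.

Lemma dir_an u v : dir G u v -> u \in an G v.
Proof. by move=> uv; rewrite inE connect1. Qed.

Lemma scE u v : (v \in sc G u) = (v \in an G u) && (u \in an G v).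
Proof. by rewrite /sc /de in_setI [X in _ && X]in_set. Qed.

Lemma sc_sym u v : (v \in sc G u) = (u \in sc G v).
Proof. by rewrite !scE andbC. Qed.

Lemma an_sc u v : v \in sc G u -> an G v = an G u.
Proof.
rewrite scE => /andP[vu uv]; apply/setP => w.
by apply/idP/idP => wu; apply: an_trans wu _.
Qed.

Definition ancestral A := forall u v, u \in an G v -> v \in A -> u \in A.

Lemma an_ancestral a : ancestral (an G a).
Proof. by move=> u v; apply: an_trans. Qed.

Lemma anU_ancestral a b : ancestral (an G a :|: an G b).
Proof.
by move=> u v uv /setUP[va|vb]; apply/setUP; [left|right];
  apply: an_trans uv _.
Qed.

Lemma anS_ancestral Z : ancestral (anS G Z).
Proof.
move=> u v uv /bigcupP[w wZ vw]; apply/bigcupP; exists w => //.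
exact: an_trans uv vw.
Qed.

Lemma sub_anS Z : Z \subset anS G Z.
Proof. by apply/subsetP => u uZ; apply/bigcupP; exists u; rewrite ?an_refl. Qed.

Lemma ancestralU A B : ancestral A -> ancestral B -> ancestral (A :|: B).
Proof.
by move=> hA hB u v uv /setUP[/(hA _ _ uv) uA|/(hB _ _ uv) uB];
  apply/setUP; [left|right].
Qed.

Lemma ancestral_sub A a : ancestral A -> a \in A -> an G a \subset A.
Proof. by move=> hA aA; apply/subsetP => u /hA; apply. Qed.

End Ancestors.

(** * Open walks *)
Section OpenWalks.
Variables (V : finType) (G : dmg V) (Z : {set V}).
Implicit Types (u v w a b c : V) (A B : {set V}) (e : edge_type)
  (s : seq (edge_type * V)) (h : bool).

(** An edge is open as soon as it does not block by itself: a non-collider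
    blocks a walk only through one of its own outgoing edges, so this part
    of sigma-blocking is a condition on single edges and survives cutting
    and splicing of walks. *)
Definition edge_open u e v : bool := edge_in G u e v &&
  match e with
  | Fwd => (u \notin Z) || (v \in sc G u)
  | Bwd => (v \notin Z) || (u \in sc G v)
  | Bi => true
  end.

(** [B] is the set of nodes allowed as colliders, and [h] records whether
    the walk so far arrived at [u] with an arrowhead, so that whether [u] is
    a collider can be decided from the next edge alone. *)
Fixpoint open_from B u h s : bool :=
  if s is (e, v) :: s' then
    [&& edge_open u e v, (h && head_left e) ==> (u \in B)
      & open_from B v (head_right e) s']
  else true.

Definition last_state u h s : V * bool :=
  (last u (map snd s), last h (map (head_right \o fst) s)).

Lemma open_cat B u h s1 s2 :
  open_from B u h (s1 ++ s2) =
  open_from B u h s1 &&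
  open_from B (last_state u h s1).1 (last_state u h s1).2 s2.
Proof.
elim: s1 u h => [//|[e v] s1 IH] u h /=.
by rewrite IH -!andbA.
Qed.

Definition reach B u h v h' : Prop :=
  exists2 s, open_from B u h s & last_state u h s = (v, h').

Lemma reach_refl B u h : reach B u h u h.
Proof. by exists [::]. Qed.

Lemma reach_trans B u h v h1 w h2 :
  reach B u h v h1 -> reach B v h1 w h2 -> reach B u h w h2.
Proof.
case=> s os ls [t ot lt]; exists (s ++ t); first by rewrite open_cat os ls.
by move: ls lt; rewrite /last_state !map_cat !last_cat => -[-> ->].
Qed.

Lemma reach_step B u h e v :
  edge_open u e v -> (h && head_left e -> u \in B) ->
  reach B u h v (head_right e).
Proof.
move=> euv cu; exists [:: (e, v)] => //=.
by rewrite euv andbT /=; apply/implyP.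
Qed.

(** A collider outside the ancestors of [Z] that is an ancestor of the far
    endpoint is repaired by walking down to it: no node of the descent is in
    [Z], and none of them is a collider. *)
Lemma reach_down B u h v : ~~ (u \in anS G Z) -> connect (dir G) u v ->
  exists h', reach B u h v h'.
Proof.
move=> uZ /connectP[p]; elim: p u h uZ => [|w p IH] u h uZ /=.
  by move=> _ ->; exists h; apply: reach_refl.
case/andP=> uw pw lv.
have wZ : w \notin anS G Z.
  by apply: contra uZ; apply: anS_ancestral (dir_an uw).
have [h' hw] := IH w true wZ pw lv; exists h'.
apply: reach_trans hw; apply: (reach_step (e := Fwd)); last by rewrite andbF.
rewrite /edge_open /= uw; apply/orP; left.
by apply: contra uZ; apply/subsetP/sub_anS.
Qed.

(** The same descent read backwards: it replaces the beginning of the walk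
    when the offending collider is an ancestor of the first endpoint.
    Arriving through a tail, the node no longer acts as a collider. *)
Lemma reach_up B u v : ~~ (u \in anS G Z) -> connect (dir G) u v ->
  reach B v false u false.
Proof.
move=> uZ /connectP[p]; elim: p u uZ => [|w p IH] u uZ /=.
  by move=> _ ->; apply: reach_refl.
case/andP=> uw pw lv.
have wZ : w \notin anS G Z.
  by apply: contra uZ; apply: anS_ancestral (dir_an uw).
apply: reach_trans (IH w wZ pw lv) _; apply: (reach_step (e := Bwd)) => //.
rewrite /edge_open /= uw; apply/orP; left.
by apply: contra uZ; apply/subsetP/sub_anS.
Qed.

(** Inside the ancestral set of the endpoints and of [Z], colliders cost
    nothing, so openness of walks reduces to connectivity in this undirected
    graph. *)
Definition passable A : rel V := fun u v =>
  [&& u \in A, v \in A &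
      [|| edge_open u Fwd v, edge_open u Bwd v | edge_open u Bi v]].

Lemma passable_edge A u v : passable A u v ->
  [/\ u \in A, v \in A & exists e, edge_open u e v].
Proof.
by case/and3P=> uA vA /or3P[] ?; split=> //;
  [exists Fwd | exists Bwd | exists Bi].
Qed.

Lemma edge_passable A u e v :
  u \in A -> v \in A -> edge_open u e v -> passable A u v.
Proof. by rewrite /passable; case: e => -> -> ->; rewrite ?orbT. Qed.

Definition rev_edge e := match e with Fwd => Bwd | Bwd => Fwd | Bi => Bi end.

Lemma rev_edge_open u e v : edge_open u e v = edge_open v (rev_edge e) u.
Proof. by case: e; rewrite /edge_open //= bidir_sym. Qed.

Lemma passable_sym A : symmetric (passable A).
Proof.
suff sub u v : passable A u v -> passable A v u by move=> u v; apply/idP/idP; apply: sub.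
by case/passable_edge=> uA vA [e]; rewrite rev_edge_open; apply: edge_passable.
Qed.

(** Every node met is an ancestor of [Z], of [a] or of [b]; the colliders of
    the last two kinds are removed one after the other by [reach_up], which
    restarts the walk from [a], and by [reach_down], which ends it in [b]. *)
Lemma passable_reach a b : connect (passable (anS G Z :|: (an G a :|: an G b))) a b ->
  exists h, reach (anS G Z) a false b h.
Proof.
set B := anS G Z; set A := _ :|: _.
move=> /connectP[p]; have := reach_refl B a false.
move: {2 3 4}a {2}false; elim: p => [|v p IH] u h au /=.
  by move=> _ ->; exists h.
case/andP=> /passable_edge[uA vA [e euv]] pv lb.
(* if [u] would be a forbidden collider, then it is an ancestor of an endpoint *)
have [cu|] := boolP ((h && head_left e) ==> (u \in B)).
  apply: (IH v (head_right e)) => //.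
  by apply: reach_trans au _; apply: reach_step => // /(implyP cu).
rewrite negb_imply => /andP[_ uB].
move: uA; rewrite !inE (negPf uB) /= => /orP[ua|ub].
  apply: (IH v (head_right e)) => //.
  apply: reach_trans (reach_up B uB ua) _.
  exact: reach_step.
have [h' ub'] := reach_down B h uB ub; exists h'.
exact: reach_trans au ub'.
Qed.

(** Following the tails out of [u], the first edge that is not directed
    forward creates a collider below [u]; it is in [B], hence so is [u]. *)
Lemma open_not_all_fwd B u s : ancestral G B -> open_from B u true s ->
  ~~ all (fun x => if x.1 is Fwd then true else false) s -> u \in B.
Proof.
move=> anB; elim: s u => //= -[[] v] s IH u /=.
- by case/andP=> /andP[/dir_an uv _] /IH vB /vB; apply: anB.
- by case/and3P.
by case/and3P.
Qed.

Lemma mem_split u s : u \in map snd s -> exists s1 e s2, s = s1 ++ (e, u) :: s2.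
Proof.
elim: s => //= -[e v] s IH; rewrite in_cons => /orP[/eqP->|].
  by exists [::], e, s.
by case/IH=> s1 [e' [s2 ->]]; exists ((e, v) :: s1), e', s2.
Qed.

(** Cutting out a loop at [u] keeps every remaining edge open, and can only
    break the collider condition at [u] itself. In the only doubtful case
    the loop leaves and re-enters [u] through tails, so it contains a
    collider below [u]. *)
Lemma open_shorten B u h s : ancestral G B -> open_from B u h s ->
  exists s', [/\ open_from B u h s', uniq (u :: map snd s')
               & last u (map snd s') = last u (map snd s)].
Proof.
move=> anB; elim: s u h => [|[e v] s IH] u h /=; first by exists [::].
case/and3P=> euv cu /IH[t [ot ut lt]].
have [ut'|] := boolP (u \in v :: map snd t); last first.
  move=> ut'; exists ((e, v) :: t); split=> //=; first by rewrite euv cu.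
  by rewrite ut'.
have {}ut' : u \in map snd t.
  move: ut'; rewrite in_cons => /orP[/eqP uv|//]; move: euv; rewrite uv.
  by case: (e); rewrite /edge_open /= ?dir_irrefl ?bidir_irrefl.
have [t1 [e' [t2 tE]]] := mem_split ut'; subst t.
case: t2 ot ut lt {ut'} => [|[e2 w] t2] ot ut lt.
- by exists [::]; split=> //=; move: lt; rewrite map_cat last_cat.
- exists ((e2, w) :: t2); split=> //; last first.
  + by rewrite -lt map_cat last_cat.
  + move: ut; rewrite map_cat -cat_cons cat_uniq => /and3P[_ _].
    by rewrite [map _ _]/=.
  move: (ot); rewrite open_cat => /andP[ot1] /= /and4P[_ _ e2w /andP[cu' ->]].
  rewrite e2w andbT /=; apply/implyP=> /andP[hh hl2].
  move: cu'; rewrite hl2 andbT => /implyP cu'.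
  case he' : (head_right e'); first exact: cu'.
  case he : (head_left e); first by apply: (implyP cu); rewrite hh he.
  have eF : e = Fwd by case: (e) he.
  subst e; have uv : u \in an G v by case/andP: euv => /dir_an.
  apply: (anB _ _ uv); apply: (open_not_all_fwd anB ot).
  by rewrite all_cat /= negb_and; case: (e') he' => //= _; rewrite orbT.
Qed.

End OpenWalks.

(** * The walk criterion for sigma-separation *)
Section Separation.
Variables (V : finType) (G : dmg V).
Implicit Types (u v w a b c d : V) (A B Z : {set V}) (e : edge_type)
  (s : seq (edge_type * V)) (h : bool).

(** The position-wise reading of [open_from], in the format of the
    definition of sigma-blocking. *)
Lemma open_fromP Z B d u h s :
  let nd := nth d (u :: map snd s) in let ed := nth Fwd (map fst s) in
  open_from G Z B u h s <->
  [/\ forall m, m < size s -> edge_open G Z (nd m) (ed m) (nd m.+1),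
      forall m, 0 < m < size s -> head_right (ed m.-1) && head_left (ed m) ->
        nd m \in B
    & 0 < size s -> h && head_left (ed 0) -> u \in B].
Proof.
elim: s u h => [|[e v] s IH] u h; first by split=> // _; split=> // -[].
split=> [|[he hc h0]]; last first.
  apply/and3P; split; first exact: (he 0).
    by apply/implyP; apply: h0.
  apply/IH; split=> [m ms|[|m] // ms|s0].
  - exact: (he m.+1).
  - exact: (hc m.+2).
  by apply: (hc 1); rewrite /= ltnS.
case/and3P=> euv /implyP cu /IH[he hc h0]; split=> //.
- by case=> [|m] //; apply: he.
case=> [|[|m]]; [by []|exact: h0|exact: (hc m.+1)].
Qed.

Lemma is_walk_edge d u s m : is_walk_from G u s -> m < size s ->
  edge_in G (nth d (u :: map snd s) m) (nth Fwd (map fst s) m)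
    (nth d (u :: map snd s) m.+1).
Proof.
elim: s u m => // -[e v] s IH u [|m] /=; first by case/andP.
by case/andP=> _ /IH; apply.
Qed.

Lemma unblockedP Z (w : walk_data V) : is_walk G w ->
  wfirst w \notin Z -> wlast w \notin Z ->
  ~ sigma_blocked G w Z <-> open_from G Z (anS G Z) w.1 false w.2.
Proof.
case: w => a s iw fZ lZ; split=> [nb|/(open_fromP _ _ a)[he hc _]]; last first.
  case=> [[]|[m [ms cm]]|[m [/andP[m0 ms] _ mZ]]]; rewrite ?(negPf fZ) ?(negPf lZ) //.
    by rewrite (hc m).
  case=> -[em sm].
    have := he m ms; rewrite /wedge /= in em *; rewrite em => /andP[_ /orP[]].
      by rewrite mZ.
    by rewrite (negPf sm).
  have ms' : m.-1 < size s by apply: leq_ltn_trans ms; apply: leq_pred.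
  have := he m.-1 ms'; rewrite /wedge /= in em; rewrite em => /andP[_].
  rewrite prednK // => /orP[]; first by rewrite mZ.
  by rewrite (negPf sm).
apply/(open_fromP _ _ a); split=> // m ms.
  rewrite /edge_open (is_walk_edge a iw ms) /=.
  case em : (nth Fwd _ m) => //; apply: contrapT => /negP;
  rewrite negb_or negbK => /andP[mZ mS];
  apply: nb; apply: Or33.
  - exists m; split=> //; last by left.
    + rewrite ms andbT; case: (m) mZ => // aZ; by rewrite /wfirst /wnode /= aZ in fZ.
    + by rewrite /collider_at /wedge /= em andbF.
  - exists m.+1; split=> //=; last by right.
    + rewrite /wlength /= ltn_neqAle ms andbT; apply: contraNneq lZ => sm.
      by rewrite /wlast /wlength /= -sm.
    + by rewrite /collider_at /wedge /= em.
move=> cm; apply: contra_notT nb => mB; apply: Or32.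
by exists m.
Qed.

(** The direction of the ancestral-graph criterion that produces an open
    path: a connection yields an open walk, and loop removal turns it into a
    path. *)
Lemma connected_not_sep Z a b : a \notin Z -> b \notin Z ->
  connect (passable G Z (anS G Z :|: (an G a :|: an G b))) a b ->
  ~ sigma_sep G [set a] [set b] Z.
Proof.
move=> aZ bZ /passable_reach[h [s os ls]] sep.
have [t [ot ut lt]] := open_shorten (@anS_ancestral _ G Z) os.
have lb : last a (map snd t) = b by rewrite lt; case: ls.
have wl : wlast (a, t) = b.
  by rewrite /wlast /wnode /wlength /= -lb -nth_last /= size_map; case: (t).
have iw : is_walk G (a, t).
  rewrite /is_walk /=; elim: (t) (a) false ot => //= -[e v] t' IH u h' /=.
  by case/and3P=> /andP[-> _] _ /IH.
have := sep (a, t); rewrite /is_path iw ut /= wl !inE !eqxx => /(_ isT isT isT).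
by apply/unblockedP => //; rewrite wl.
Qed.

(** From every node of an open walk, tails lead in one of the two directions
    to a collider or to an endpoint. *)
Lemma open_ancestral Z B A u h s : ancestral G A -> B \subset A ->
  open_from G Z B u h s -> (~~ h -> u \in A) -> last u (map snd s) \in A ->
  all (mem A) (u :: map snd s).
Proof.
move=> hA /subsetP BA os.
have fwd x t : open_from G Z B x true t -> last x (map snd t) \in A -> x \in A.
  elim: t x => //= -[[] v] t IH x /=.
  - by case/andP=> /andP[/dir_an xv _] /IH vA /vA; apply: hA.
  - by case/and3P=> _ /BA.
  by case/and3P=> _ /BA.
elim: s u h os => [|[e v] s IH] u h; first by move=> _ _ /= ->.
move=> os uA lA; have {}uA : u \in A.
  by case: h os uA => [os _|_]; [apply: fwd os lA | apply].
rewrite [all _ _]/= [X in X && _]uA.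
case/and3P: os => euv _ os; apply: IH os _ lA => hr.
have eB : e = Bwd by case: (e) hr.
by move: euv; rewrite eB => /andP[/dir_an vu _]; apply: hA uA.
Qed.

(** * Inducing links *)

(** Bidirected edges and strong connectedness play the same role: in the
    acyclifications of the graph, two nodes of one component can be joined
    by a bidirected edge. *)
Definition district_step A : rel V := fun u v =>
  [&& u \in A, v \in A & bidir G u v || (v \in sc G u)].
Definition district A : rel V := connect (district_step A).
Definition arm A u d := (d \in A) && ((u == d) || dir G u d).
Definition into A u v := exists2 d, arm A u d & district A d v.
Definition link A u v := exists2 d, arm A v d & into A u d.
(** The existence of an inducing path, as a property of districts: inside
    the ancestors of the two nodes, both belong to, or point into, one
    district. *)
Definition inducing u v := link (an G u :|: an G v) u v.

Lemma district_step_sym A : symmetric (district_step A).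
Proof. by move=> u v; rewrite /district_step bidir_sym sc_sym andbCA. Qed.

Lemma district_sym A : symmetric (district A).
Proof. exact: sym_connect_sym (@district_step_sym A). Qed.

Lemma district_trans A v u w : district A u v -> district A v w -> district A u w.
Proof. exact: connect_trans. Qed.

Lemma into_district A u v w : into A u v -> district A v w -> into A u w.
Proof. by case=> d ud dv vw; exists d => //; apply: district_trans vw. Qed.

Lemma link_sym A u v : link A u v -> link A v u.
Proof.
case=> d vd [d' ud' dd']; exists d' => //; exists d => //.
by rewrite district_sym.
Qed.

Lemma into_link A u v w : into A u v -> into A w v -> link A u w.
Proof.
case=> d ud dv [d' wd' dv']; exists d' => //; exists d => //.
by apply: district_trans dv _; rewrite district_sym.
Qed.

Lemma district_sub A B u v : A \subset B -> district A u v -> district B u v.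
Proof.
move=> /subsetP AB; apply: connect_sub => x y /and3P[/AB xB /AB yB xy].
by apply: connect1; rewrite /district_step xB yB.
Qed.

Lemma arm_sub A B u v : A \subset B -> arm A u v -> arm B u v.
Proof. by move=> /subsetP AB /andP[/AB vB uv]; rewrite /arm vB. Qed.

Lemma into_sub A B u v : A \subset B -> into A u v -> into B u v.
Proof.
by move=> AB [d ud dv]; exists d; [apply: arm_sub ud|apply: district_sub dv].
Qed.

Lemma link_sub A B u v : A \subset B -> link A u v -> link B u v.
Proof.
by move=> AB [d ud dv]; exists d; [apply: arm_sub ud|apply: into_sub dv].
Qed.

Lemma arm_refl A u : u \in A -> arm A u u.
Proof. by rewrite /arm eqxx => ->. Qed.

Lemma district_into A u v : u \in A -> district A u v -> into A u v.
Proof. by move=> uA uv; exists u => //; apply: arm_refl. Qed.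

Lemma link_into A u v : v \in A -> into A u v -> link A u v.
Proof. by move=> vA uv; exists v => //; apply: arm_refl. Qed.

Lemma sc_district A u v : u \in A -> v \in A -> v \in sc G u -> district A u v.
Proof. by move=> uA vA uv; apply: connect1; rewrite /district_step uA vA uv orbT. Qed.

Lemma inducing_sym u v : inducing u v -> inducing v u.
Proof. by rewrite /inducing setUC; apply: link_sym. Qed.

(** The graphical meaning of an arrowhead at [v]: the inducing path enters
    [v]. If [v] only pointed into the district, at [d], then [d] would be an
    ancestor of [u], which is excluded, or of [v], and then [d] and [v] are
    strongly connected. *)
Lemma inducing_into A u v : an G u \subset A -> an G v \subset A ->
  inducing u v -> v \notin an G u -> into A u v.
Proof.
move=> uA vA [d /andP[dA vd] ud] vu.
apply: (@into_sub (an G u :|: an G v)); first by rewrite subUset uA.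
case/predU1P: vd => [vd|vd]; first by rewrite [X in into _ _ X]vd.
apply: into_district ud _.
have dv : d \in an G v.
  case/setUP: dA => // du; case/negP: vu; apply: an_trans du; exact: dir_an.
apply: sc_district => //; first by apply/setUP; right; apply: an_refl.
by rewrite scE (dir_an vd).
Qed.

Lemma inducing_district A u v : an G u \subset A -> an G v \subset A ->
  inducing u v -> v \notin an G u -> u \notin an G v -> district A u v.
Proof.
move=> uA vA uv vu nuv.
have [d /andP[dA ud] dv] := inducing_into (subsetUl _ _) (subsetUr _ _) uv vu.
apply: (@district_sub (an G u :|: an G v)); first by rewrite subUset uA.
case/predU1P: ud => [ud|ud]; first by rewrite [X in district _ X _]ud.
apply: district_trans dv.
have du : d \in an G u.
  case/setUP: dA => // dv'; case/negP: nuv; apply: an_trans dv'; exact: dir_an.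
apply: sc_district => //; first by apply/setUP; left; apply: an_refl.
by rewrite sc_sym scE (dir_an ud).
Qed.

(** The arms of a link leave nodes outside [Z], and its district edges are
    never blocked, because directed edges within a component never are. *)
Lemma link_passable A Z u v : an G u \subset A -> an G v \subset A ->
  ancestral G A ->
  u \notin Z -> v \notin Z -> link A u v -> connect (passable G Z A) u v.
Proof.
move=> /subsetP uA /subsetP vA hA uZ vZ.
have armP x d : x \in A -> x \notin Z -> arm A x d -> connect (passable G Z A) x d.
  move=> xA xZ /andP[dA /predU1P[->|xd]]; first exact: connect0.
  by apply: connect1; apply: (edge_passable (e := Fwd)) => //; rewrite /edge_open /= xd xZ.
case=> d /armP vd [d' /armP ud'] dd'.
apply: connect_trans (ud' (uA _ (an_refl _ _)) uZ) _.
apply: (@connect_trans _ _ d); last first.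
  by rewrite (sym_connect_sym (@passable_sym _ _ _ _)); apply: vd vZ; apply: vA (an_refl _ _).
move: dd'; apply: connect_sub => {d d' vd ud'} x y /and3P[xA yA /orP[xy|]].
  by apply: connect1; apply: (edge_passable (e := Bi)) => //; rewrite /edge_open /= xy.
rewrite scE => /andP[yx]; rewrite inE => /connectP[p].
elim: p x xA yx => [|z p IH] x xA yx /=; first by move=> _ ->; apply: connect0.
case/andP=> xz pz yl.
have zy : z \in an G y by rewrite inE; apply/connectP; exists p.
have zA : z \in A by apply: hA zy yA.
apply: (@connect_trans _ _ z); last first.
  by apply: IH => //; apply: an_trans yx _; apply: dir_an.
apply: connect1; apply: (edge_passable (e := Fwd)) => //; rewrite /edge_open /= xz /=.
by apply/orP; right; rewrite scE (dir_an xz) andbT; apply: an_trans zy yx.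
Qed.

Lemma link_not_sep Z a b : a \notin Z -> b \notin Z ->
  inducing a b -> ~ sigma_sep G [set a] [set b] Z.
Proof.
move=> aZ bZ ab; apply: connected_not_sep => //.
set A := _ :|: _.
have aA : an G a \subset A by rewrite /A setUCA subsetUl.
have bA : an G b \subset A by rewrite /A setUA subsetUr.
apply: link_passable => //.
  by apply: ancestralU; [apply: anS_ancestral|apply: anU_ancestral].
by apply: link_sub ab; apply: subsetUr.
Qed.

(** For the conditioning set consisting of all other ancestors, every inner
    node of an open path is conditioned on; the path can leave a component
    only through an edge out of one of its two endpoints, which is exactly a
    link. *)
Lemma not_sep_link a b : a != b ->
  ~ sigma_sep G [set a] [set b] ((an G a :|: an G b) :\: [set a; b]) ->
  inducing a b.
Proof.
set A := an G a :|: an G b; set Z := _ :\: _ => ab nsep.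
have hA : ancestral G A := anU_ancestral (a := a) (b := b).
have aA : a \in A by apply/setUP; left; apply: an_refl.
have bA : b \in A by apply/setUP; right; apply: an_refl.
have inZ u : (u \in Z) = [&& u != a, u != b & u \in A].
  by rewrite in_setD !inE negb_or andbA.
have [[a' s] [iw fa lb nb]] : exists w : walk_data V, [/\ is_path G w, wfirst w \in [set a],
  wlast w \in [set b] & ~ sigma_blocked G w Z].
  apply: contra_notP nsep => H p ip fp lp; apply: contrapT => nb.
  by apply: H; exists p.
move: fa; rewrite inE => /eqP fa; rewrite /wfirst /wnode /= in fa; subst a'.
move: lb; rewrite inE => /eqP lb.
have {}lb' : last a (map snd s) = b.
  by rewrite -lb /wlast /wnode /wlength /= -nth_last /= size_map; case: (s).
case/andP: iw => iw us.
have os : open_from G Z (anS G Z) a false s.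
  apply/(unblockedP (w := (a, s))) => //; last by rewrite lb inZ eqxx andbF.
  by rewrite /wfirst /wnode /= inZ eqxx.
have BA : anS G Z \subset A.
  apply/bigcupsP => u; rewrite inZ => /and3P[_ _ uA]; exact: ancestral_sub.
have : all (mem A) (a :: map snd s).
  by apply: open_ancestral os _ _ => //; rewrite lb'.
have step u e v : u \in A -> v \in A -> u \in Z -> v != a -> edge_open G Z u e v ->
  district_step A u v \/ v = b /\ dir G v u.
  move=> uA vA uZ va; rewrite /edge_open /district_step uA vA.
  case: e => /andP[/= uv].
  - by rewrite uZ /= => ->; left; rewrite orbT.
  - rewrite inZ va vA andbT /= negbK => /orP[/eqP vb|]; first by right; split.
    by rewrite sc_sym => ->; left; rewrite orbT.
  by left; rewrite uv.
have rec u h t : into A a u -> open_from G Z (anS G Z) u h t ->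
  uniq (u :: map snd t) -> a \notin u :: map snd t -> last u (map snd t) = b ->
  all (mem A) (u :: map snd t) -> link A a b.
  elim: t u h => [|[e v] t IH] u h au.
    by move=> _ _ _ /= <- /andP[uA _]; apply: link_into.
  case/and3P=> euv _ ot /andP[ut ut'] ant lt /andP[uA tA].
  have {}uA : u \in A := uA.
  have vA : v \in A by case/andP: tA.
  have [va vt] : v != a /\ a \notin v :: map snd t.
    move: ant; rewrite inE negb_or => /andP[_ ant]; split=> //.
    by move: ant; rewrite inE negb_or eq_sym => /andP[].
  have ub : u != b.
    apply: contraNneq ut => ->; rewrite -lt /=; exact: mem_last.
  have uZ : u \in Z.
    move: ant; rewrite inE negb_or eq_sym => /andP[ua _].
    by rewrite inZ ub uA ua.
  have [uv|[vb vu]] := step _ _ _ uA vA uZ va euv.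
    apply: IH ot _ _ _ _ => //; apply: into_district au _; exact: connect1.
  by exists u => //; rewrite /arm uA -vb vu orbT.
case: s us os lb' {iw nb lb} => [|[e v] s] /=; first by move=> _ _ /eqP; rewrite (negPf ab).
case/andP=> avs us /andP[eav os] lb' /and3P[_ vA sA].
have va : v != a by move: avs; rewrite inE negb_or eq_sym => /andP[].
have [av|[vb vu]] : into A a v \/ v = b /\ dir G v a.
- case: e eav os => /andP[/= av].
  + by move=> _ _; left; exists v; [rewrite /arm vA av orbT|apply: connect0].
  + rewrite inZ va vA andbT /= negbK => /orP[/eqP vb|]; first by right; split.
    rewrite sc_sym => sva _; left; exists a; first exact: arm_refl.
    by apply: sc_district => //; rewrite sc_sym.
  + move=> _ _; left; exists a; first exact: arm_refl.
    by apply: connect1; rewrite /district_step aA vA av.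
- by apply: rec av os _ _ _ _ => //=; rewrite ?us ?vA.
exists a; first by rewrite /arm aA -vb vu orbT.
by exists a; [apply: arm_refl|apply: connect0].
Qed.

End Separation.

(** * Consequences of a separation *)
Section SeparationFacts.
Variables (V : finType) (G : dmg V).
Implicit Types (u v w a b c d x : V) (A B Z : {set V}).

Lemma sc_inducing u v : v \in sc G u -> inducing G u v.
Proof.
move=> uv; have [uA vA] : u \in an G u :|: an G v /\ v \in an G u :|: an G v.
  by split; apply/setUP; [left|right]; apply: an_refl.
by apply: link_into => //; apply: district_into => //; apply: sc_district.
Qed.

(** A path entering [i] through an arrowhead can be prolonged inside the
    component of [i]; this is the source of all symmetry between [i] and
    [j]. *)
Lemma inducing_sc k i j : inducing G k i -> i \notin an G k -> j \in sc G i ->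
  inducing G k j.
Proof.
move=> ki nik ij; rewrite /inducing (an_sc ij).
have iA : i \in an G k :|: an G i by apply/setUP; right; apply: an_refl.
have jA : j \in an G k :|: an G i.
  by apply/setUP; right; move: ij; rewrite scE => /andP[].
apply: link_into => //; apply: into_district (sc_district iA jA ij).
by apply: inducing_into ki nik; [apply: subsetUl|apply: subsetUr].
Qed.

Section Sep.
Variables (Z : {set V}) (a b : V).
Hypotheses (aZ : a \notin Z) (bZ : b \notin Z)
  (sep : sigma_sep G [set a] [set b] Z).

Let A := anS G Z :|: (an G a :|: an G b).

Let aA : an G a \subset A. Proof. by rewrite /A setUCA subsetUl. Qed.
Let bA : an G b \subset A. Proof. by rewrite /A setUA subsetUr. Qed.
Let hA : ancestral G A.
Proof. by apply: ancestralU; [apply: anS_ancestral|apply: anU_ancestral]. Qed.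

Let ZA u : u \in Z -> an G u \subset A.
Proof.
move=> uZ; apply: subset_trans (subsetUl _ _).
by apply: ancestral_sub; [apply: anS_ancestral|apply: (subsetP (sub_anS G Z))].
Qed.

Let inducing_link u v : an G u \subset A -> an G v \subset A -> inducing G u v ->
  link G A u v.
Proof. by move=> uA vA; apply: link_sub; rewrite subUset uA. Qed.

Lemma sep_no_link : ~ link G A a b.
Proof.
move=> ab; apply: (connected_not_sep aZ bZ) sep.
exact: (link_passable aA bA hA aZ bZ ab).
Qed.

Lemma sep_no_link2 c : an G c \subset A -> c \notin Z ->
  link G A a c -> link G A c b -> False.
Proof.
move=> cA cZ ac cb; apply: (connected_not_sep aZ bZ) sep.
apply: (@connect_trans _ _ c).
  exact: (link_passable aA cA hA aZ cZ ac).
exact: (link_passable cA bA hA cZ bZ cb).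
Qed.

(** If [c] were an ancestor of [a] or [b], both links would live in the
    ancestral set of the separation and meet at the unconditioned node [c]. *)
Lemma notin_sep_collider c : inducing G a c -> inducing G c b -> c \notin Z ->
  c \notin an G a /\ c \notin an G b.
Proof.
move=> ac cb cZ.
have ncA : ~~ (an G c \subset A).
  by apply/negP=> cA; apply: (sep_no_link2 cA cZ); apply: inducing_link.
by split; apply: contra ncA => cP; apply: subset_trans (ancestral_sub _ cP) _ => //;
  apply: an_ancestral.
Qed.

(** Otherwise both links enter [c] through arrowheads, hence lie in one
    district, and link [a] and [b] directly. *)
Lemma in_sep_noncollider c : inducing G a c -> inducing G c b -> c \in Z ->
  (c \in an G a) || (c \in an G b).
Proof.
move=> ac cb cZ; apply: contrapT => /negP; rewrite negb_or => /andP[ca ncb].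
apply: sep_no_link; apply: (@into_link _ _ _ _ c).
  by apply: inducing_into ac ca => //; apply: ZA.
by apply: inducing_into (inducing_sym cb) ncb => //; apply: ZA.
Qed.

(** A discriminating path from [f 0] to [b] for the node [f n.+1], expressed
    by ancestry: all the colliders [f 1], ..., [f n] are ancestors of [b]
    and form one district that [f 0] points into or belongs to. Whether [f
    n.+1] is a collider on the path is thus a question on the link between
    [f n.+1] and [b] alone. *)
Section Discriminating.
Variables (f : nat -> V) (n : nat).
Hypotheses (n0 : 0 < n) (f0 : f 0 = a)
  (find : forall m, m <= n -> inducing G (f m) (f m.+1))
  (flast : inducing G (f n.+1) b)
  (fb : forall m, 0 < m <= n -> f m \in an G b)
  (fprev : forall m, 0 < m <= n -> f m \notin an G (f m.-1))
  (fnext : forall m, 0 < m <= n -> f m \notin an G (f m.+1)).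

Let fA m : 0 < m <= n -> an G (f m) \subset A.
Proof. by move=> /fb mb; apply: ancestral_sub => //; apply: (subsetP bA). Qed.

Let a_into m : 0 < m <= n -> into G A a (f m).
Proof.
elim: m => // m IH mn.
case: m => [|m] in IH mn *.
  have := fprev mn; have := find (leq0n n); rewrite /= f0.
  by apply: inducing_into => //; apply: fA.
have mn' : 0 < m.+1 <= n by case/andP: mn => _ /ltnW ->.
apply: into_district (IH mn') _; apply: inducing_district (fnext mn') => //.
- exact: fA.
- exact: fA.
- by apply: find; case/andP: mn'.
exact: (fprev mn).
Qed.

Let n0n : 0 < n <= n. Proof. by rewrite n0 leqnn. Qed.

Let last_into : an G (f n.+1) \subset A -> into G A (f n.+1) (f n).
Proof.
move=> lA; apply: inducing_into (fnext n0n) => //; first exact: fA.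
exact/inducing_sym/find.
Qed.

Lemma discriminated_notin_an : b \notin an G (f n.+1).
Proof.
apply: contra (fnext n0n) => bl; exact: an_trans (fb n0n) bl.
Qed.

Lemma discriminated_noncollider : f n.+1 \in Z -> f n.+1 \in an G b.
Proof.
move=> lZ; apply: contrapT => /negP lb; have lA := ZA lZ.
apply: sep_no_link; apply: link_sym.
have bl : into G A b (f n.+1).
  by apply: inducing_into (inducing_sym flast) lb.
apply: into_link bl _; apply: into_district (a_into n0n) _.
rewrite district_sym; apply: (inducing_district lA (fA n0n) _ (fnext n0n)).
  exact/inducing_sym/find.
by apply: contra lb => lf; apply: an_trans lf (fb n0n).
Qed.

Lemma discriminated_collider : f n.+1 \notin Z -> f n.+1 \notin an G b.
Proof.
move=> lZ; apply/negP=> lb.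
have lA : an G (f n.+1) \subset A.
  by apply: subset_trans bA; apply: ancestral_sub => //; apply: an_ancestral.
apply: (sep_no_link2 lA lZ); last exact: inducing_link.
exact: into_link (a_into n0n) (last_into lA).
Qed.

End Discriminating.
End Sep.
End SeparationFacts.

(** * Context nodes *)
Section Context.
Variables (V : finType) (G : dmg V) (K : {set V}).
Hypothesis hG : jci123 G K.
Implicit Types (u v w a b c d k i j : V).

Lemma context_an k u : k \in K -> u \in an G k -> u = k.
Proof.
case: hG => ex _ ge kK; rewrite inE => /connectP[p].
case/lastP: p => [//|p k']; rewrite rcons_path last_rcons => /andP[_ wk] kk'.
rewrite -{}kk' in wk; set w := last u p in wk.
have [wK|wK] := boolP (w \in K); last first.
  by have := ex k w kK; rewrite inE wK wk => /(_ isT).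
have [wk'|wk'] := eqVneq w k; first by rewrite wk' dir_irrefl in wk.
by have [_] := ge w k wK kK wk'; rewrite wk.
Qed.

Lemma context_sc k u : k \in K -> u \in sc G k -> u = k.
Proof. by move=> kK; rewrite scE => /andP[/(context_an kK)]. Qed.

Lemma district_context A u v : district G A u v -> u \in K -> v \in K.
Proof.
case: hG => _ ra _ /connectP[p]; elim: p u => [|w p IH] u /=; first by move=> _ ->.
case/andP=> /and3P[_ _ uw] pw lv uK; apply: IH pw lv _.
case/orP: uw => [uw|/(context_sc uK) -> //].
apply: contrapT => /negP wK; have := ra u w uK.
by rewrite inE wK bidir_sym uw => /(_ isT).
Qed.

(** A context node is adjacent by bidirected edges to other context nodes
    only, so a link from it to a system node must start with a directed
    edge. *)
Lemma context_system k i : k \in K -> i \notin K -> inducing G k i ->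
  k \in an G i /\ i \notin an G k.
Proof.
move=> kK iK ki.
have ik : i \notin an G k by apply: contraNN iK => /(context_an kK) ->.
split=> //; have [d /andP[dA kd] di] := inducing_into (subsetUl _ _) (subsetUr _ _) ki ik.
case/predU1P: kd => [kd|kd].
  by move: iK; rewrite (district_context di) // -kd.
case/setUP: dA => [/(context_an kK) dk|di']; first by rewrite dk dir_irrefl in kd.
by apply: an_trans di'; apply: dir_an.
Qed.

(** Pairs of context nodes, which the algorithm joins without any test, are
    joined by a bidirected edge anyway; so all adjacencies have one meaning. *)
Lemma adjacentP u v :
  reflect (u != v /\ inducing G u v) (fci_adjacent K (IM_sigma G) u v).
Proof.
have [_ _ ge] := hG.
apply: (iffP andP) => -[uv uvK]; split=> //.
  case/orP: uvK => [/andP[uK vK]|/existsPn nsep].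
    have [buv _] := ge u v uK vK uv.
    have [uA vA] : u \in an G u :|: an G v /\ v \in an G u :|: an G v.
      by split; apply/setUP; [left|right]; apply: an_refl.
    apply: link_into => //; apply: district_into => //.
    by apply: connect1; rewrite /district_step uA vA buv.
  apply: not_sep_link => // sep; have := nsep ((an G u :|: an G v) :\: [set u; v]).
  apply/negP; rewrite negbK; apply/andP; split; first by rewrite setDE subsetIr.
  by rewrite inE; apply/asboolP.
apply/orP; right; apply/existsPn => Z; apply/negP=> /andP[/subsetP sZ].
rewrite inE => /asboolP /= sep.
by apply: link_not_sep uvK sep; apply/negP => /sZ; rewrite !inE eqxx ?orbT.
Qed.

End Context.

(** * Discriminating paths as functions *)
Section DiscriminatingPaths.
Variable V : finType.
Implicit Types (P : pgraph V) (f : nat -> V) (n m : nat) (x a b c : V).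

(** Discriminating paths in functional form: [f 0] is the far endpoint, [f
    n.+1] the discriminated node and [c] the near endpoint. Segments and
    changes of one node, needed below, are then index computations. *)
Record dpath P f n c : Prop := DPath {
  dp_pos : 0 < n;
  dp_inj : {in [pred m | m <= n.+1] &, injective f};
  dp_fresh : forall m, m <= n.+1 -> f m != c;
  dp_adj : forall m, m <= n -> adj P (f m) (f m.+1);
  dp_last : adj P (f n.+1) c;
  dp_nonadj : nonadj P (f 0) c;
  dp_prev : forall m, 0 < m <= n -> star_arrow P (f m.-1) (f m);
  dp_next : forall m, 0 < m <= n -> star_arrow P (f m.+1) (f m);
  dp_dir : forall m, 0 < m <= n -> p_dir P (f m) c
}.

Lemma discriminating_dpath P x q a b c : discriminating P x q a b c ->
  exists f n, [/\ dpath P f n c, f 0 = x, f n = a & f n.+1 = b].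
Proof.
set p := q ++ [:: a; b; c]; case=> up ap nxc hm.
exists (nth x (x :: p)), (size q).+1.
have sp : size p = (size q).+3 by rewrite size_cat addn3.
have ea : nth x p (size q) = a by rewrite nth_cat ltnn subnn.
have eb : nth x p (size q).+1 = b.
  by rewrite nth_cat ltnNge leqnSn /= subSnn.
have ec : nth x p (size q).+2 = c.
  by rewrite nth_cat ltnNge leqW //= subSn // subSnn.
split=> //; split=> //.
- move=> m m'; rewrite !inE => lm lm' /eqP; rewrite nth_uniq //= ?sp; [by move/eqP|lia..].
- move=> m lm; rewrite -[X in _ != X]ec -[nth x p _]/(nth x (x :: p) (size q).+3).
  rewrite nth_uniq //= ?sp; lia.
- by move=> m lm; apply: (pathP x ap); rewrite sp; lia.
- rewrite -[X in adj _ _ X]ec; apply: (pathP x ap (size q).+2).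
  by rewrite sp.
- by move=> m /hm[].
- by move=> m /hm[].
by move=> m /hm[].
Qed.

Lemma dpath_discriminating P f n c : dpath P f n c ->
  exists x q a, discriminating P x q a (f n.+1) c.
Proof.
case=> n0 finj ffr fadj flast fnon fprev fnext fdir.
exists (f 0), (mkseq (fun m => f m.+1) n.-1), (f n).
(* the node sequence, extended by the value [c] at position [n.+2] *)
set g := fun m => if m <= n.+1 then f m else c.
rewrite /discriminating; set p := _ ++ _.
have pE : f 0 :: p = mkseq g n.+3.
  have -> : p = mkseq (fun m => g m.+1) n.+2.
    have -> : n.+2 = n.-1 + 3 by rewrite addn3 prednK.
    rewrite /p /mkseq iotaD map_cat; congr (_ ++ _).
      apply/eq_in_map => m; rewrite mem_iota add0n /g => /andP[_ mn].
      by rewrite ltnS ifT // ltnW // (leq_trans mn (leq_pred n)).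
    by rewrite /= /g prednK // ltnn leqnSn leqnn.
  by rewrite /mkseq -[iota 0 n.+3]/(0 :: iota (1 + 0) n.+2) iotaDl map_cons -map_comp.
have sp : size p = n.+2 by have := congr1 size pE; rewrite size_mkseq /= => -[].
have pN m : m < n.+3 -> nth (f 0) (f 0 :: p) m = g m by rewrite pE; apply: nth_mkseq.
have gS m : m <= n.+1 -> g m = f m by rewrite /g => ->.
split=> //.
- rewrite [X in uniq X]pE map_inj_in_uniq ?iota_uniq // => m m'.
  rewrite !mem_iota !add0n !ltnS /= /g => lm lm'.
  case: leqP => hm; case: leqP => hm'.
  + exact: finj.
  + by move=> e; have := ffr m hm; rewrite e eqxx.
  + by move=> e; have := ffr m' hm'; rewrite e eqxx.
  + lia.
- apply/(pathP (f 0)) => m; rewrite sp ltnS => lm.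
  rewrite -[nth (f 0) p m]/(nth (f 0) (f 0 :: p) m.+1) !pN; [|lia..].
  rewrite gS //; have [hm|hm] := leqP m n; first by rewrite gS //; apply: fadj.
  have -> : m = n.+1 by lia.
  by rewrite /g ltnn.
move=> m; rewrite size_mkseq prednK // => lm.
case/andP: (lm) => m0 mn.
rewrite !pN; [|lia..]; rewrite !gS; [|lia..].
by split; [apply: fprev|apply: fnext|apply: fdir].
Qed.

End DiscriminatingPaths.

(** * Ancestral soundness of the orientation rules *)
Section Marks.
Variable V : finType.
Implicit Types (P Q : pgraph V) (u v a b c : V).

Lemma set_markE P u v m a b :
  set_mark P u v m (a, b) = if (a == u) && (b == v) then Some m else P (a, b).
Proof. by rewrite ffunE. Qed.

Lemma orientE P u mu mv v a b : orient P u mu mv v (a, b) =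
  if (a == u) && (b == v) then Some mv
  else if (a == v) && (b == u) then Some mu else P (a, b).
Proof. by rewrite /orient !set_markE. Qed.

End Marks.

Section Soundness.
Variables (V : finType) (G : dmg V) (K : {set V}).
Hypothesis hG : jci123 G K.
Variable sepset : {set V} -> {set V}.
Hypothesis hsep : valid_sepset K (IM_sigma G) sepset.
Implicit Types (P Q : pgraph V) (u v w a b c d x i j k : V).

Local Notation sk := (fci_adjacent K (IM_sigma G)).
Local Notation an := (an G).

Lemma sk_sym u v : sk u v = sk v u.
Proof.
by apply/(adjacentP hG)/(adjacentP hG); rewrite eq_sym => -[uv /inducing_sym].
Qed.

Lemma sk_neq u v : sk u v -> u != v.
Proof. by case/andP. Qed.

Lemma sk_sc u v : u != v -> v \in sc G u -> sk u v.
Proof. by move=> uv /sc_inducing ?; apply/(adjacentP hG). Qed.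

Lemma sk_into_sc k i j : sk k i -> i \notin an k -> j \in sc G i -> sk k j.
Proof.
move=> /(adjacentP hG)[_ ki] ik ij; apply/(adjacentP hG).
split; last exact: inducing_sc ij.
apply: contraNneq ik => ->; by move: ij; rewrite scE => /andP[].
Qed.

Lemma sepsetP a b : a != b -> ~~ sk a b ->
  [/\ a \notin sepset [set a; b], b \notin sepset [set a; b]
    & sigma_sep G [set a] [set b] (sepset [set a; b])].
Proof.
move=> ab nab; have /andP[/subsetP sub] := hsep ab nab.
rewrite inE => /asboolP /= sep.
by split=> //; apply/negP => /sub; rewrite !inE eqxx ?orbT.
Qed.

Lemma sepset_noncollider a b c : a != b -> ~~ sk a b -> sk a c -> sk c b ->
  c \in sepset [set a; b] -> (c \in an a) || (c \in an b).
Proof.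
move=> ab nab /(adjacentP hG)[_ ac] /(adjacentP hG)[_ cb].
have [aZ bZ sep] := sepsetP ab nab.
exact: (in_sep_noncollider aZ bZ sep ac cb).
Qed.

Lemma sepset_collider a b c : a != b -> ~~ sk a b -> sk a c -> sk c b ->
  c \notin sepset [set a; b] -> c \notin an a /\ c \notin an b.
Proof.
move=> ab nab /(adjacentP hG)[_ ac] /(adjacentP hG)[_ cb].
have [aZ bZ sep] := sepsetP ab nab.
exact: (notin_sep_collider aZ bZ sep ac cb).
Qed.

(** Arrowheads and tails carry their ancestral meaning, and an unshielded
    triple without an arrowhead at one side of its middle node is a genuine
    non-collider. The last clause is what remains of the separating sets
    once the unshielded colliders have been oriented. *)
Record sound P : Prop := Sound {
  sound_adj : forall u v, adj P u v = sk u v;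
  sound_arrow : forall u v, P (u, v) = Some Arrow -> v \notin an u;
  sound_tail : forall u v, P (u, v) = Some Tail -> v \in an u;
  sound_tail_arrow : forall u v, P (u, v) = Some Tail -> P (v, u) = Some Arrow;
  sound_nc : forall a b c, sk a b -> sk b c -> a != c -> ~~ sk a c ->
    P (c, b) <> Some Arrow -> (b \in an a) || (b \in an c)
}.

(** Rules may overwrite marks, but ancestral soundness determines a mark
    that is not a circle, so that only circles ever change. *)
Definition extends P Q := forall u v m, m <> Circle ->
  P (u, v) = Some m -> Q (u, v) = Some m.

Lemma extends_refl P : extends P P. Proof. by []. Qed.

Lemma extends_trans P Q R : extends P Q -> extends Q R -> extends P R.
Proof. by move=> PQ QR u v m mC /(PQ _ _ _ mC) /(QR _ _ _ mC). Qed.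

Section SoundTheory.
Variable P : pgraph V.
Hypothesis sP : sound P.

Lemma mark_sk u v m : P (u, v) = Some m -> sk u v.
Proof. by rewrite -(sound_adj sP) /adj => ->. Qed.

Lemma sk_mark u v : sk u v -> 
  [\/ P (u, v) = Some Circle, P (u, v) = Some Arrow | P (u, v) = Some Tail].
Proof.
rewrite -(sound_adj sP) /adj; case: (P (u, v)) => // -[] _;
by [apply: Or31 | apply: Or32 | apply: Or33].
Qed.

Lemma nonadjE u v : nonadj P u v = (u != v) && ~~ sk u v.
Proof. by rewrite /nonadj (sound_adj sP). Qed.

Lemma tail_dir u v : P (v, u) = Some Tail -> p_dir P u v.
Proof. by move=> t; split=> //; apply: sound_tail_arrow t. Qed.

Lemma p_dir_an u v : p_dir P u v -> u \in an v /\ v \notin an u.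
Proof. by case=> t a; split; [apply: sound_tail t | apply: sound_arrow a]. Qed.

Lemma sound_set_arrow u v : sk u v -> v \notin an u ->
  sound (set_mark P u v Arrow) /\ extends P (set_mark P u v Arrow).
Proof.
move=> uv vu; split; last first.
  move=> a b m mC abm; rewrite set_markE; case: ifP => // /andP[/eqP ea /eqP eb].
  move: abm mC; rewrite ea eb; case: m => // t.
  by case/negP: vu; apply: sound_tail t.
split.
- move=> a b; rewrite -(sound_adj sP) /adj set_markE; case: ifP => // /andP[/eqP-> /eqP->].
  by move: uv; rewrite -(sound_adj sP) /adj => ->.
- by move=> a b; rewrite set_markE; case: ifP => [/andP[/eqP-> /eqP->]|_ /(sound_arrow sP)].
- by move=> a b; rewrite set_markE; case: ifP => [//|_ /(sound_tail sP)].
- move=> a b; rewrite !set_markE; case: ifP => [//|_ /(sound_tail_arrow sP) ->].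
  by case: ifP.
- move=> a b c ab bc ac nac h; apply: (sound_nc sP) ab bc ac nac _ => h'.
  by apply: h; rewrite set_markE h'; case: ifP.
Qed.

Lemma sound_set_dir u v : sk u v -> u \in an v -> v \notin an u ->
  sound (orient P u Tail Arrow v) /\ extends P (orient P u Tail Arrow v).
Proof.
move=> uv au vu; have uNv : (u == v) = false by apply/negbTE/sk_neq.
have vNu : (v == u) = false by rewrite eq_sym.
split; last first.
  move=> a b m mC abm; rewrite orientE; case: ifP => [/andP[/eqP ea /eqP eb]|_].
    move: abm mC; rewrite ea eb; case: m => // t.
    by case/negP: vu; apply: sound_tail t.
  case: ifP => // /andP[/eqP ea /eqP eb].
  move: abm mC; rewrite ea eb; case: m => // t.
  by have := sound_arrow sP t; rewrite au.
split.
- move=> a b; rewrite -(sound_adj sP) /adj orientE.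
  case: ifP => [/andP[/eqP-> /eqP->]|_].
    by move: uv; rewrite -(sound_adj sP) /adj => ->.
  case: ifP => // /andP[/eqP-> /eqP->].
  by move: uv; rewrite sk_sym -(sound_adj sP) /adj => ->.
- move=> a b; rewrite orientE; case: ifP => [/andP[/eqP-> /eqP->] //|_].
  by case: ifP => // _ /(sound_arrow sP).
- move=> a b; rewrite orientE; case: ifP => // _.
  by case: ifP => [/andP[/eqP-> /eqP->] //|_ /(sound_tail sP)].
- move=> a b; rewrite !orientE; case: ifP => // abn.
  case: ifP => [/andP[/eqP-> /eqP->]|_ t]; first by rewrite !eqxx.
  have := sound_tail_arrow sP t; case: ifP => // _ ar; case: ifP => // /andP[/eqP eb /eqP ea].
  by move: abn; rewrite ea eb !eqxx.
- move=> a b c ab bc ac nac h; apply: contrapT => /negP; rewrite negb_or => /andP[ba nbc].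
  have bA : P (c, b) = Some Arrow.
    apply: contrapT => h'; have := sound_nc sP ab bc ac nac h'.
    by rewrite (negPf ba) (negPf nbc).
  apply: h; rewrite orientE bA; case: ifP => // _; case: ifP => // /andP[/eqP ec /eqP eb].
  by move: nbc; rewrite ec eb au.
Qed.

(** With [b] not an ancestor of [a], being a non-collider forces [b] to be
    an ancestor of [c]; and [b], [c] in one component would make [a]
    adjacent to [c]. *)
Lemma unshielded_child a b c : sk a b -> b \notin an a -> sk b c ->
  (a != c) && ~~ sk a c -> P (c, b) <> Some Arrow -> b \in an c /\ c \notin an b.
Proof.
move=> ab ba bc /andP[ac nac] cb.
have := sound_nc sP ab bc ac nac cb; rewrite (negPf ba) /= => bc'; split=> //.
apply: contra nac => cb'; apply: sk_into_sc ab ba _.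
by rewrite scE cb' bc'.
Qed.

Lemma dpath_semantics f n c : dpath P f n c ->
  [/\ c \notin an (f n.+1),
      f n.+1 \in sepset [set f 0; c] -> f n.+1 \in an c
    & f n.+1 \notin sepset [set f 0; c] -> f n.+1 \notin an c].
Proof.
case=> n0 finj ffr fadj flast fnon fprev fnext fdir.
have [x0 nx0] : f 0 != c /\ ~~ sk (f 0) c by move: fnon; rewrite nonadjE => /andP.
have [aZ bZ sep] := sepsetP x0 nx0.
have ind m : m <= n -> inducing G (f m) (f m.+1).
  by move/fadj; rewrite (sound_adj sP) => /(adjacentP hG)[].
have indl : inducing G (f n.+1) c.
  by move: flast; rewrite (sound_adj sP) => /(adjacentP hG)[].
have anc m : 0 < m <= n -> f m \in an c by move/fdir/p_dir_an => [].
have anp m : 0 < m <= n -> f m \notin an (f m.-1) by move/fprev/(sound_arrow sP).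
have ann m : 0 < m <= n -> f m \notin an (f m.+1) by move/fnext/(sound_arrow sP).
split.
- exact: (discriminated_notin_an n0 anc ann).
- exact: (discriminated_noncollider aZ bZ sep n0 erefl ind indl anc anp ann).
- exact: (discriminated_collider aZ bZ sep n0 erefl ind indl anc anp ann).
Qed.

End SoundTheory.

Lemma sound_set_bidir P u v : sound P -> sk u v -> v \notin an u -> u \notin an v ->
  sound (orient P u Arrow Arrow v) /\ extends P (orient P u Arrow Arrow v).
Proof.
move=> sP uv vu nuv; have vku : sk v u by rewrite sk_sym.
have [s1 e1] := sound_set_arrow sP vku nuv.
have [s2 e2] := sound_set_arrow s1 uv vu.
by split=> //; apply: extends_trans e1 e2.
Qed.

(** Each conclusion is an ancestral consequence of the premises: R1 by
    [unshielded_child], R2 by transitivity, R3 since [d] is an ancestor of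
    [a] or [c], R4 by the analysis of discriminating paths. *)
Lemma step14_sound P Q : sound P -> fci_step14 sepset P Q -> sound Q /\ extends P Q.
Proof.
move=> sP; case.
- move=> a b c ab cb ac.
  have skbc : sk b c by rewrite sk_sym; apply: mark_sk cb.
  have [bc cb'] : b \in an c /\ c \notin an b.
    apply: (unshielded_child sP (mark_sk sP ab) (sound_arrow sP ab) skbc).
      by rewrite -(nonadjE sP).
    by rewrite cb.
  exact: sound_set_dir.
- move=> a b c hyp ac; apply: sound_set_arrow => //; first exact: (mark_sk sP ac).
  case: hyp => [[/(p_dir_an sP)[ab _] /(sound_arrow sP)]|
      [/(sound_arrow sP) ba /(p_dir_an sP)[bc _]]].
    by apply: contra => ca; apply: an_trans ca ab.
  by apply: contra ba => ca; apply: an_trans bc ca.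
- move=> a b c d ab cb ad cd ac db; apply: sound_set_arrow => //; first exact: (mark_sk sP db).
  have [ba bc] := (sound_arrow sP ab, sound_arrow sP cb).
  move: ac; rewrite (nonadjE sP) => /andP[ac nac].
  have skdc : sk d c by rewrite sk_sym; apply: mark_sk cd.
  have : (d \in an a) || (d \in an c).
    by apply: (sound_nc sP) (mark_sk sP ad) skdc ac nac _; rewrite cd.
  case/orP=> dP; [apply: contra ba|apply: contra bc] => bd; exact: an_trans bd dP.
- move=> x q a b c /discriminating_dpath[f [n [df fx fa fb]]] cb bS.
  rewrite -fx -fb in bS *; have [cb' bc _] := dpath_semantics sP df.
  apply: sound_set_dir => //; last exact: bc.
  by rewrite -(sound_adj sP); apply: dp_last df.
move=> x q a b c /discriminating_dpath[f [n [df fx fa fb]]] cb bS.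
rewrite -fx -fb -fa in bS *; have [cb' _ bc] := dpath_semantics sP df.
have n0n : 0 < n <= n by rewrite (dp_pos df) leqnn.
have [ac ca] := p_dir_an sP (dp_dir df n0n).
have skl : sk (f n.+1) c by rewrite -(sound_adj sP); apply: dp_last df.
have skn : sk (f n) (f n.+1) by rewrite -(sound_adj sP); exact: (dp_adj df (leqnn n)).
have nb : f n \notin an (f n.+1) by apply: sound_arrow (dp_next df n0n).
have bn : f n.+1 \notin an (f n) by apply: contra (bc bS) => ba; apply: an_trans ba ac.
have [s1 e1] := sound_set_bidir sP skn bn nb.
have [s2 e2] := sound_set_bidir s1 skl cb' (bc bS).
by split=> //; apply: extends_trans e1 e2.
Qed.

End Soundness.

(** * Soundness of the initial graph and of the tail rules *)
Section Runs.
Variables (V : finType) (G : dmg V) (K : {set V}).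
Hypothesis hG : jci123 G K.
Variable sepset : {set V} -> {set V}.
Hypothesis hsep : valid_sepset K (IM_sigma G) sepset.
Implicit Types (P Q : pgraph V) (u v w a b c d x i j k : V).

Local Notation sk := (fci_adjacent K (IM_sigma G)).
Local Notation an := (an G).

Definition initial_pgraph : pgraph V :=
  fci_background K (fci_R0 sepset (fci_skeleton K (IM_sigma G))).

Definition shows_collider u v b :=
  [&& sk v b, u != b, ~~ sk u b & v \notin sepset [set u; b]].

Lemma initialE u v : initial_pgraph (u, v) =
  if sk u v then
    match u \in K, v \in K with
    | true, _ => Some Arrow
    | false, true => Some Tail
    | false, false =>
      if [exists b, shows_collider u v b] then Some Arrow else Some Circle
    end
  else None.
Proof.
have skE a b : adj (fci_skeleton K (IM_sigma G)) a b = sk a b.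
  by rewrite /adj ffunE /=; case: (sk a b).
have R0E a b : fci_R0 sepset (fci_skeleton K (IM_sigma G)) (a, b) =
    if sk a b then
      if [exists c, shows_collider a b c] then Some Arrow else Some Circle
    else None.
  rewrite ffunE /=.
  have -> : [exists c, unshielded (fci_skeleton K (IM_sigma G)) a b c &&
       (b \notin sepset [set a; c])] = sk a b && [exists c, shows_collider a b c].
    rewrite /unshielded; apply/existsP/andP => [[c]|[ab /existsP[c]]]; last first.
      by case/and4P=> bc ac nac bS; exists c; rewrite /nonadj !skE ab bc ac nac.
    rewrite /nonadj !skE => /andP[/and3P[ab bc /andP[ac nac]] bS]; split=> //.
    by apply/existsP; exists c; rewrite /shows_collider bc ac nac.
  rewrite ffunE /=; case: (sk a b) => //=.
rewrite ffunE /= /adj R0E; case: (sk u v) => /=; last by [].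
by case: [exists c, _] => /=; case: (u \in K); case: (v \in K).
Qed.

Lemma initial_sound : sound G K initial_pgraph.
Proof.
have ctx u v : sk u v -> u \in K -> v \notin an u.
  move=> uv uK; have [_ uv'] := adjacentP hG u v uv.
  have [vK|vK] := boolP (v \in K); last by have [] := context_system hG uK vK uv'.
  by apply: contraNN (sk_neq uv) => /(context_an hG uK) ->.
split.
- move=> u v; rewrite /adj initialE; case: (sk u v) => //.
  by case: (u \in K); case: (v \in K) => //; case: ifP.
- move=> u v; rewrite initialE; case: ifP => // uv.
  case: ifP => uK; first by move=> _; apply: ctx.
  case: ifP => // vK; case: ifP => // /existsP[b /and4P[vb ub nub vS]] _.
  by have [] := sepset_collider hG hsep ub nub uv vb vS.
- move=> u v; rewrite initialE; case: ifP => // uv.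
  case: ifP => uK //; case: ifP => vK; last by case: ifP.
  move=> _; have [_ uv'] := adjacentP hG u v uv.
  by have [] := context_system hG vK (negbT uK) (inducing_sym uv').
- move=> u v; rewrite !initialE (sk_sym hG); case: ifP => // uv.
  by case: ifP => uK //; case: ifP => vK //; case: ifP.
move=> a b c ab bc ac nac; have cb : sk c b by rewrite (sk_sym hG).
rewrite initialE cb; case: ifP => cK //; case: ifP => bK.
  move=> _; have [_ bc'] := adjacentP hG b c bc.
  by have [-> _] := context_system hG bK (negbT cK) bc'; rewrite orbT.
case: ifP => // /negbT/existsPn/(_ a) nex _; apply: (sepset_noncollider hG hsep) => //.
apply: contraR nex => bS.
by rewrite /shows_collider (sk_sym hG) ab eq_sym ac (sk_sym hG) nac setUC.
Qed.

(** Tails always face arrowheads, so a possibly directed edge is one without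
    an arrowhead at its start. *)
Lemma possibly_dirP P u v : sound G K P ->
  reflect (sk u v /\ P (v, u) <> Some Arrow) (possibly_dir_edge P u v).
Proof.
move=> sP; rewrite /possibly_dir_edge; apply: (iffP idP) => [|[uv nvu]].
  case vu : (P (v, u)) => [[]|] //; rewrite (sk_sym hG) (mark_sk sP vu);
  by case: (P (u, v)) => [[]|].
have vu : sk v u by rewrite (sk_sym hG).
case: (sk_mark sP vu) => // h; rewrite h.
  case: (sk_mark sP uv) => [->|->|h'] //.
  by have := sound_tail_arrow sP h'.
by rewrite (sound_tail_arrow sP h).
Qed.

Section Uncovered.
Variables (P : pgraph V) (a : V) (p : seq V) (c : V).
Hypotheses (sP : sound G K P) (pP : uncovered_possibly_dir P a p c).
Let v m := nth a (a :: p) m.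

Lemma uncovered_edge m : m < size p -> sk (v m) (v m.+1) /\ P (v m.+1, v m) <> Some Arrow.
Proof.
case: pP => _ pp _ _ mp; apply/(possibly_dirP _ _ sP).
exact: (pathP a pp).
Qed.

(** Along an uncovered possibly directed path no triple is a collider; so
    once a step is ancestrally strict, [unshielded_child] propagates
    strictness to the end. *)
Lemma uncovered_descends m l : 0 < m -> m <= l <= size p -> v m \notin an (v m.-1) ->
  v m \in an (v l) /\ v l \notin an (v l.-1).
Proof.
move=> m0; elim: l => [|l IH]; first by lia.
rewrite leq_eqVlt => /andP[/orP[/eqP <- _ vm|ml lp vm]]; first by rewrite an_refl.
have [ml' nl] : v m \in an (v l) /\ v l \notin an (v l.-1) by apply: IH vm; lia.
have l0 : 0 < l by lia.
have [e1 _] : sk (v l.-1) (v l) /\ P (v l, v l.-1) <> Some Arrow.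
  have := @uncovered_edge l.-1; rewrite prednK //; apply; lia.
have [e2 n2] := uncovered_edge lp.
have : nonadj P (v l.-1) (v l.+1).
  case: pP => _ _ _ /(_ l.+1) h; have := h; rewrite -[l.+1 - 2]/(l - 1) subn1; apply; lia.
rewrite (nonadjE sP) => un.
have [ln nln] := unshielded_child hG sP e1 nl e2 un n2.
by split=> //; apply: an_trans ml' ln.
Qed.

Lemma uncovered_an : 0 < size p -> v 1 \notin an a -> a \in an (v 1) -> a \in an c.
Proof.
move=> p0 h1 a1; have lc : v (size p) = c.
  by case: pP => _ _ <- _; rewrite -nth_last /v; case: (p) p0.
have [] := @uncovered_descends 1 (size p) isT _ h1; first by rewrite p0 leqnn.
by rewrite lc => ac _; apply: an_trans ac.
Qed.

End Uncovered.

(** For R9 and R10 suppose that [a] is not an ancestor of [c]. Some path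
    starts from [a] with a triple that is not a collider at [a], so [a] is
    an ancestor of its first node; if that step is strict then
    [uncovered_an] applies. If it stays in the component of [a], then in R9
    the first node is adjacent to [c], and in R10 the first step of the
    other path is strict. *)
Lemma step810_sound P Q : sound G K P -> fci_step810 P Q ->
  [/\ sound G K Q, extends P Q & forall e, Q e = Some Arrow -> P e = Some Arrow].
Proof.
move=> sP pq.
have [a [c [ac an_ac ->]]] : exists a c, [/\ p_circ_arrow P a c, a \in an c &
    Q = orient P a Tail Arrow c].
  case: pq => {Q}.
  - move=> a b c /(p_dir_an sP)[ab _] /(p_dir_an sP)[bc _] ac; exists a, c.
    by split=> //; apply: an_trans ab bc.
  - move=> a b p c ac pd; rewrite (nonadjE sP) => /andP[bc nbc]; exists a, c; split=> //.
    have [_ aca] := ac; have cna := sound_arrow sP aca; have skac := mark_sk sP aca.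
    have [ab nba] := uncovered_edge sP pd (isT : 0 < size (b :: p)).
    apply: contrapT => /negP nac.
    have : (a \in an c) || (a \in an b).
      apply: (sound_nc sP) nba => //; first by rewrite (sk_sym hG).
        by rewrite eq_sym.
      by rewrite (sk_sym hG).
    rewrite (negPf nac) /= => an_ab.
    have [ba|ba] := boolP (b \in an a).
      case/negP: nbc; rewrite (sk_sym hG).
      apply: (sk_into_sc hG) nac _; first by rewrite (sk_sym hG).
      by rewrite scE ba an_ab.
    by case/negP: nac; apply: uncovered_an pd _ ba an_ab.
  move=> a b c d m1 p1 m2 p2 ac bc dc pd1 pd2 m12; exists a, c; split=> //.
  have [bc' _] := p_dir_an sP bc; have [dc' _] := p_dir_an sP dc.
  move: m12; rewrite (nonadjE sP) => /andP[m12 nm12].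
  have [am1 nm1] := uncovered_edge sP pd1 (isT : 0 < size (m1 :: p1)).
  have [am2 nm2] := uncovered_edge sP pd2 (isT : 0 < size (m2 :: p2)).
  have both x y : sk a x -> sk a y -> x != y -> ~~ sk x y -> a \in an x ->
      x \in an a -> a \in an y /\ y \notin an a.
    move=> ax ay xy nxy an_ax xa.
    have scx : x \in sc G a by rewrite scE xa an_ax.
    have an_ay : a \in an y.
      apply: contraNT nxy => nay; rewrite (sk_sym hG).
      by apply: (sk_into_sc hG) nay scx; rewrite (sk_sym hG).
    split=> //; apply: contra nxy => ya; apply: (sk_sc hG) => //.
    have scy : y \in sc G a by rewrite scE ya an_ay.
    by rewrite scE (an_trans ya an_ax) (an_sc scy).
  have : (a \in an m1) || (a \in an m2).
    apply: (sound_nc sP) nm2 => //; by rewrite (sk_sym hG).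
  case/orP=> h.
    have [m1a|m1a] := boolP (m1 \in an a).
      have [h2 m2a] := both _ _ am1 am2 m12 nm12 h m1a.
      by apply: an_trans dc'; apply: uncovered_an pd2 _ m2a h2.
    by apply: an_trans bc'; apply: uncovered_an pd1 _ m1a h.
  have [m2a|m2a] := boolP (m2 \in an a).
    have [h1 m1a] : a \in an m1 /\ m1 \notin an a.
      by apply: both am2 am1 _ _ h m2a; rewrite 1?eq_sym 1?(sk_sym hG).
    by apply: an_trans bc'; apply: uncovered_an pd1 _ m1a h1.
  by apply: an_trans dc'; apply: uncovered_an pd2 _ m2a h.
have [_ aca] := ac.
have [sQ eQ] := sound_set_dir hG sP (mark_sk sP aca) an_ac (sound_arrow sP aca).
split=> // -[u v]; rewrite orientE; case: ifP => [/andP[/eqP-> /eqP->] //|_].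
by case: ifP.
Qed.

End Runs.

(** * Arrowheads pass across circles *)
Section Arrowheads.
Variables (V : finType) (G : dmg V) (K : {set V}).
Hypothesis hG : jci123 G K.
Variable sepset : {set V} -> {set V}.
Hypothesis hsep : valid_sepset K (IM_sigma G) sepset.
Implicit Types (P Q : pgraph V) (u v w a b c d e x : V).

Local Notation sk := (fci_adjacent K (IM_sigma G)).
Local Notation an := (an G).

Variable T : pgraph V.
Hypotheses (sT : sound G K T) (hT : forall Q, ~ fci_step14 sepset T Q).

Lemma terminal_adj a b c : T (a, b) = Some Arrow -> T (c, b) = Some Circle ->
  a != c -> sk a c.
Proof.
move=> ab cb ac; apply: contrapT => /negP nac; apply: hT.
by apply: R1 ab cb _; rewrite (nonadjE sT) ac.
Qed.

Lemma dir_arrow_trans a b c : p_dir T a b -> T (b, c) = Some Arrow -> sk a c ->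
  T (a, c) = Some Arrow.
Proof.
move=> ab bc ac; case: (sk_mark sT ac) => // h.
  by case: (hT (R2 sepset (or_introl (conj ab bc)) h)).
have [a_b _] := p_dir_an sT ab; case/negP: (sound_arrow sT bc).
exact: an_trans (sound_tail sT h) a_b.
Qed.

Lemma arrow_dir_trans a b c : T (a, b) = Some Arrow -> p_dir T b c -> sk a c ->
  T (a, c) = Some Arrow.
Proof.
move=> ab bc ac; case: (sk_mark sT ac) => // h.
  by case: (hT (R2 sepset (or_intror (conj ab bc)) h)).
have [b_c _] := p_dir_an sT bc; case/negP: (sound_arrow sT ab).
exact: an_trans b_c (sound_tail sT h).
Qed.

Lemma terminal_discriminated f n c : dpath T f n c ->
  T (c, f n.+1) <> Some Circle.
Proof.
move=> /dpath_discriminating[x [q [a dis]]] cb.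
have [bS|bS] := boolP (f n.+1 \in sepset [set x; c]).
  exact: hT (R4_in dis cb bS).
exact: hT (R4_out dis cb bS).
Qed.

(** A tail at [c] on the edge between [a] and [c] would let R2 put an
    arrowhead in place of the circle at [b]. *)
Lemma arrow_circle a b c : T (a, b) = Some Arrow -> T (c, b) = Some Circle ->
  a != c -> T (a, c) = Some Circle \/ T (a, c) = Some Arrow.
Proof.
move=> ab cb ac; case: (sk_mark sT (terminal_adj ab cb ac)) => h; [by left|by right|].
have := dir_arrow_trans (tail_dir sT h) ab (mark_sk sT cb).
by rewrite cb.
Qed.

Lemma dpath_extends P f n c : sound G K P -> extends P T -> dpath P f n c ->
  dpath T f n c.
Proof.
move=> sP PT [n0 finj ffr fadj flast fnon fprev fnext fdir]; split=> //.
- by move=> m /fadj; rewrite (sound_adj sP) (sound_adj sT).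
- by rewrite (sound_adj sT) -(sound_adj sP).
- by rewrite (nonadjE sT) -(nonadjE sP).
- by move=> m /fprev /PT; apply.
- by move=> m /fnext /PT; apply.
by move=> m /fdir[/PT h1 /PT h2]; split; [apply: h1|apply: h2].
Qed.

Section AlongDiscriminatingPath.
Variables (f : nat -> V) (n : nat) (c e : V).
Hypothesis (df : dpath T f n c) (fresh : forall m, m <= n.+1 -> f m != e).

(** Cutting a discriminating path at its collider [f k] and continuing with
    [e] gives a discriminating path for [e], so that R4 has already decided
    the mark at [e]. *)
Lemma dpath_new_collider k : 0 < k <= n -> T (e, f k) = Some Arrow -> sk e c ->
  T (c, e) <> Some Circle.
Proof.
move=> kn ek ec; have [n0 finj ffr fadj flast fnon fprev fnext fdir] := df.
set g := fun m => if m <= k then f m else e.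
have gk m : m <= k -> g m = f m by rewrite /g => ->.
have ge : g k.+1 = e by rewrite /g ltnn.
have := @terminal_discriminated g k c; rewrite ge; apply.
split.
- by case/andP: kn.
- move=> m m'; rewrite !inE /g => lm lm'.
  case: leqP => hm; case: leqP => hm'.
  + by apply: finj; rewrite inE; lia.
  + move=> h; have fr : f m != e by apply: fresh; lia.
    by rewrite h eqxx in fr.
  + move=> h; have fr : f m' != e by apply: fresh; lia.
    by rewrite -h eqxx in fr.
  + lia.
- move=> m lm; have [hm|hm] := leqP m k; first by rewrite gk //; apply: ffr; lia.
  have -> : m = k.+1 by lia.
  rewrite ge; apply: sk_neq ec.
- move=> m lm; rewrite gk //; have [hm|hm] := leqP m.+1 k.
    by rewrite gk //; apply: fadj; lia.
  have -> : m = k by lia.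
  by rewrite ge (sound_adj sT) (sk_sym hG); apply: mark_sk ek.
- by rewrite ge (sound_adj sT).
- by rewrite gk.
- by move=> m lm; rewrite !gk; [apply: fprev; lia|lia..].
- move=> m lm; rewrite [g m]gk; last by lia.
  have [hm|hm] := leqP m.+1 k; first by rewrite gk //; apply: fnext; lia.
  have -> : m = k by lia.
  by rewrite ge.
- by move=> m lm; rewrite gk; [apply: fdir|]; lia.
Qed.

(** The segment of the path that starts at [f j], closed by the new endpoint
    [e], is discriminating for the node after [f (j + l)]. *)
Lemma dpath_new_end j l : 0 < l -> j + l <= n -> nonadj T (f j) e ->
  (forall m, j < m <= j + l -> T (e, f m) = Some Tail) -> sk (f (j + l).+1) e ->
  T (e, f (j + l).+1) <> Some Circle.
Proof.
move=> l0 jl nje te ske; have [n0 finj ffr fadj flast fnon fprev fnext fdir] := df.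
set g := fun m => f (j + m).
have := @terminal_discriminated g l e; rewrite /g addnS; apply.
split=> //; rewrite ?addnS ?addn0 //.
- move=> m m'; rewrite !inE => lm lm' /finj; rewrite !inE => h.
  by apply/eqP; rewrite -(eqn_add2l j); apply/eqP/h; lia.
- by move=> m lm; apply: fresh; lia.
- by move=> m lm; rewrite addnS; apply: fadj; lia.
- by rewrite (sound_adj sT).
- move=> m lm; have -> : j + m.-1 = (j + m).-1 by lia.
  by apply: fprev; lia.
- by move=> m lm; rewrite addnS; apply: fnext; lia.
by move=> m lm; apply: (tail_dir sT); apply: te; lia.
Qed.

End AlongDiscriminatingPath.

(** Zhang's property: an arrowhead at [b] coming from [a] is transmitted
    across any circle at [b] to the node at the other end of that edge. The
    arrowheads of [P] are compared with the circles of the terminal graph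
    [T], so that the property can be proved by induction along a run that
    ends in [T]. *)
Definition arrows_spread P := forall a b e, P (a, b) = Some Arrow ->
  T (e, b) = Some Circle -> a != e -> T (a, e) = Some Arrow.

Section Step.
Variable P : pgraph V.
Hypotheses (sP : sound G K P) (PT : extends P T) (zP : arrows_spread P).

Let arrowT a b : P (a, b) = Some Arrow -> T (a, b) = Some Arrow.
Proof. exact: PT. Qed.

Let dirT a b : p_dir P a b -> p_dir T a b.
Proof. by case=> t h; split; apply: PT. Qed.

(** The arrowhead at [c] coming from [b] is older, hence already transmitted
    to [e]; R2 is then applied again, with [e] in place of [c]. *)
Lemma spread_R2 a b c e :
  (p_dir P a b /\ star_arrow P b c) \/ (star_arrow P a b /\ p_dir P b c) ->
  T (a, c) = Some Arrow -> T (e, c) = Some Circle -> a != e ->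
  T (a, e) = Some Arrow.
Proof.
move=> hyp ac ec ae; have ske := terminal_adj ac ec ae.
have bc : P (b, c) = Some Arrow by case: hyp => [[]|[_ []]].
have be : T (b, e) = Some Arrow.
  apply: (zP bc ec); apply/eqP=> be; move: (arrowT bc); by rewrite be ec.
case: hyp => [[/dirT ab _]|[ab /dirT dbc]]; first exact: dir_arrow_trans ab be ske.
have skeb : sk e b by rewrite (sk_sym hG); apply: mark_sk be.
case: (sk_mark sT skeb) => h.
- exact: zP ab h ae.
- by have := arrow_dir_trans h dbc (mark_sk sT ec); rewrite ec.
exact: arrow_dir_trans (arrowT ab) (tail_dir sT h) ske.
Qed.

Lemma spread_R1 a b c e : star_arrow P a b -> nonadj P a c ->
  p_dir T b c -> T (e, c) = Some Circle -> b != e -> T (b, e) = Some Arrow.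
Proof.
move=> ab; rewrite (nonadjE sP) => /andP[ac nac] bc ec be; have [_ bca] := bc.
have ae : a != e.
  by apply: contraNneq nac => ->; apply: mark_sk ec.
have [circ|//] := arrow_circle bca ec be.
have skeb : sk e b by rewrite (sk_sym hG); apply: mark_sk circ.
case: (sk_mark sT skeb) => h.
- have aeA := zP ab h ae.
  have skce : sk c e by rewrite (sk_sym hG); apply: mark_sk ec.
  case: (sk_mark sT skce) => h'.
  + by case/negP: nac; apply: terminal_adj aeA h' ac.
  + exact: dir_arrow_trans bc h' (mark_sk sT circ).
  + by have := sound_tail_arrow sT h'; rewrite ec.
- by have := arrow_dir_trans h bc (mark_sk sT ec); rewrite ec.
by have := sound_tail_arrow sT h.
Qed.

Lemma spread_R3 a b c d e : star_arrow P a b -> star_arrow P c b ->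
  star_circ P a d -> star_circ P c d -> nonadj P a c ->
  T (d, b) = Some Arrow -> T (e, b) = Some Circle -> d != e ->
  T (d, e) = Some Arrow.
Proof.
move=> ab cb ad cd; rewrite (nonadjE sP) => /andP[ac nac] db eb de.
have [circ|//] := arrow_circle db eb de; have skde := mark_sk sT circ.
have ne x : P (x, b) = Some Arrow -> x != e.
  by move=> xb; apply/eqP=> xe; move: (arrowT xb); rewrite xe eb.
have ae := zP ab eb (ne _ ab); have ce := zP cb eb (ne _ cb).
have to x : T (x, d) = Some Tail -> T (x, e) = Some Arrow -> T (d, e) = Some Arrow.
  by move=> h xe; apply: dir_arrow_trans (tail_dir sT h) xe skde.
have dac : (d \in an a) || (d \in an c).
  apply: (sound_nc sP) (mark_sk sP ad) _ ac nac _; last by rewrite cd.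
  by rewrite (sk_sym hG); apply: mark_sk cd.
have nca : c != a by rewrite eq_sym.
case: (sk_mark sT (mark_sk sP ad)) => [hA|hA|hA]; last exact: to hA ae.
  case: (sk_mark sT (mark_sk sP cd)) => [hC|hC|hC]; last exact: to hC ce.
    have nadj : nonadj T a c by rewrite (nonadjE sT) ac.
    by case: (hT (R3 sepset ae ce hA hC nadj circ)).
  by have := terminal_adj hC hA nca; rewrite (sk_sym hG) (negPf nac).
case: (sk_mark sT (mark_sk sP cd)) => [hC|hC|hC]; last exact: to hC ce.
  by have := terminal_adj hA hC ac; rewrite (negPf nac).
by move: dac; rewrite (negPf (sound_arrow sT hA)) (negPf (sound_arrow sT hC)).
Qed.

Section R4.
Variables (f : nat -> V) (n : nat) (c : V).
Hypothesis df : dpath P f n c.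

Let dT : dpath T f n c. Proof. exact: dpath_extends df. Qed.
Let n0n : 0 < n <= n. Proof. by rewrite (dp_pos df) leqnn. Qed.
Let nf0c : ~~ sk (f 0) c.
Proof. by have := dp_nonadj df; rewrite (nonadjE sP) => /andP[]. Qed.
Let f0c : f 0 != c. Proof. exact: (dp_fresh df). Qed.

(** All colliders of the path transmit to [e] their older arrowheads at [c].
    If [f 0] also has an arrowhead at [e], then by R1 the edge between [e]
    and [c] has no circle at [e], and R2 gives the conclusion. Otherwise [f
    0] is not adjacent to [e], and the path with endpoint [e] is
    discriminating for each of its nodes in turn, which turns the marks at
    [f 1], ..., [f n] into tails and leaves no circle at [f n.+1]. *)
Lemma spread_R4_in e : p_dir T (f n.+1) c -> T (e, c) = Some Circle ->
  f n.+1 != e -> T (f n.+1, e) = Some Arrow.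
Proof.
move=> bc ec be; have [_ bca] := bc; have [circ|//] := arrow_circle bca ec be.
have ske := mark_sk sT ec; have skce : sk c e by rewrite (sk_sym hG).
have fe m : 0 < m <= n -> f m != e.
  by move=> mn; apply/eqP=> h; have [_] := dp_dir dT mn; rewrite h ec.
have f0e : f 0 != e by apply: contraNneq nf0c => ->.
have fresh m : m <= n.+1 -> f m != e.
  case: m => [//|m] mn; have [?|?] := leqP m.+1 n; first by apply: fe; lia.
  by have -> : m.+1 = n.+1 by lia.
have fmeA m : 0 < m <= n -> T (f m, e) = Some Arrow.
  by move=> mn; have [_ a] := dp_dir df mn; apply: zP a ec (fe _ mn).
have [f0A|f0A] := pselect (T (f 0, e) = Some Arrow).
  case: (sk_mark sT skce) => h.
  - by case/negP: nf0c; apply: terminal_adj f0A h f0c.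
  - exact: dir_arrow_trans bc h (mark_sk sT circ).
  by have := sound_tail_arrow sT h; rewrite ec.
have noA m : 0 < m <= n -> T (e, f m) <> Some Arrow.
  by move=> mn h; have := arrow_dir_trans h (dp_dir dT mn) ske; rewrite ec.
have skm m : 0 < m <= n -> sk (e) (f m).
  by move=> mn; rewrite (sk_sym hG); apply: mark_sk (fmeA m mn).
have one : 0 < 1 <= n by rewrite (dp_pos df).
have t1 : T (e, f 1) = Some Tail.
  case: (sk_mark sT (skm 1 one)) => // h; last by case: (noA _ one h).
  by case: f0A; apply: zP (dp_prev df one) h f0e.
have nf0e : nonadj T (f 0) e.
  rewrite (nonadjE sT) f0e; apply/negP=> sk0; apply: f0A.
  exact: arrow_dir_trans (dp_prev dT one) (tail_dir sT t1) sk0.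
have tails m : 0 < m <= n -> forall i, 0 < i <= m -> T (e, f i) = Some Tail.
  elim: m => [|m IH] mn i im; first by lia.
  have [il|il] := leqP i m; first by apply: IH; lia.
  have -> : i = m.+1 by lia.
  case: m => [//|m] in IH mn im il *.
  case: (sk_mark sT (skm _ mn)) => // h; last by case: (noA _ mn h).
  have := @dpath_new_end f n c e dT fresh 0 m.+1 isT _ nf0e; rewrite add0n.
  case=> //; first by lia.
    by move=> m' hm'; apply: IH; lia.
  by rewrite (sk_sym hG); apply: skm.
have skbe : sk e (f n.+1) by rewrite (sk_sym hG); apply: mark_sk circ.
case: (sk_mark sT skbe) => h.
- have := @dpath_new_end f n c e dT fresh 0 n (dp_pos df) (leqnn n) nf0e; rewrite add0n.
  case=> //; first exact: tails.
  by rewrite (sk_sym hG).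
- by have := arrow_dir_trans h bc ske; rewrite ec.
exact: (sound_tail_arrow sT h).
Qed.

(** The arrowheads at [e] propagate back along the path to [f 0], where R1
    removes the circle at [e] on the edge to [c]. At a collider [f k] with a
    circle facing [e] an older arrowhead is transmitted; with an arrowhead,
    the path cut at [f k] would discriminate [e]; with a tail, R2 applies
    unless the predecessor of [f k] is not adjacent to [e], and then a run
    of tails ending in a circle gives a discriminating path to which R4
    would still apply. *)
Lemma no_back_arrows e s : (forall m, m <= n.+1 -> f m != e) -> sk e c ->
  T (c, e) = Some Circle -> 0 < s <= n.+1 -> T (e, f s) = Some Circle ->
  T (f s.-1, e) <> Some Arrow.
Proof.
move=> fresh ske ce sn es; move=> h.
(* [l] is the first position after [k] at which the mark facing [e] is a circle *)
suff : forall k l, k < l <= s -> T (f k, e) = Some Arrow -> T (e, f l) = Some Circle ->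
    (forall m, k < m < l -> T (e, f m) = Some Tail) -> False.
  by move/(_ s.-1 s); apply=> //; [lia|move=> m; lia].
elim=> [|k IH] l kl fk el tl.
  by case/negP: nf0c; apply: terminal_adj fk ce f0c.
have kn : 0 < k.+1 <= n by lia.
have skk : sk e (f k.+1) by rewrite (sk_sym hG); apply: mark_sk fk.
have fke : f k != e by apply: fresh; lia.
case: (sk_mark sT skk) => h'.
- apply: (IH k.+1 _ _ h'); [lia| |by move=> m; lia].
  exact: (zP (dp_prev df kn) h' fke).
- exact: (dpath_new_collider dT fresh kn h' ske ce).
have tl' m : k < m < l -> T (e, f m) = Some Tail.
  move=> km; have [|mk] := leqP m k.+1; last by apply: tl; lia.
  by move=> mk; have -> : m = k.+1 by lia.
have [skke|nskke] := boolP (sk (f k) e).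
  apply: (IH l _ _ el tl'); first by lia.
  exact: arrow_dir_trans (dp_prev dT kn) (tail_dir sT h') skke.
have := @dpath_new_end f n c e dT fresh k (l - k).-1.
have -> : (k + (l - k).-1).+1 = l by lia.
apply=> //; [lia|lia| | |].
- by rewrite (nonadjE sT) fke.
- by move=> m km; apply: tl'; lia.
by rewrite (sk_sym hG); apply: mark_sk el.
Qed.

Hypotheses (ab : T (f n, f n.+1) = Some Arrow) (cb : T (c, f n.+1) = Some Arrow).
Variable e : V.
Hypothesis eb : T (e, f n.+1) = Some Circle.

Let ce : c != e. Proof. by apply/eqP=> h; move: cb; rewrite h eb. Qed.
Let ae : f n != e. Proof. by apply/eqP=> h; move: ab; rewrite h eb. Qed.
Let ske : sk e c. Proof. by rewrite (sk_sym hG); apply: terminal_adj cb eb ce. Qed.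

Let fresh : T (c, e) = Some Circle -> forall m, m <= n.+1 -> f m != e.
Proof.
move=> cC m mn; apply/eqP=> h.
have [m0|m0] := posnP m; first by case/negP: nf0c; rewrite -m0 h.
have [hm|hm] := leqP m n.
  have mn' : 0 < m <= n by rewrite m0.
  by have [] := dp_dir dT mn'; rewrite h cC.
have mE : m = n.+1 by lia.
by have := sk_neq (mark_sk sT eb); rewrite -h mE eqxx.
Qed.

(** A circle at [f n] facing [e] lets the older arrowhead at [f n] pass to
    [e], against [no_back_arrows]; an arrowhead there makes [e]
    discriminated. *)
Lemma spread_R4_left : T (f n, e) = Some Arrow.
Proof.
have [circ|//] := arrow_circle ab eb ae.
have skae := mark_sk sT circ.
have [cC|cA] := arrow_circle cb eb ce; last first.
  exact: dir_arrow_trans (dp_dir dT n0n) cA skae.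
have skea : sk e (f n) by rewrite (sk_sym hG).
case: (sk_mark sT skea) => h.
- have nn : 0 < n <= n.+1 by lia.
  case: (no_back_arrows (fresh cC) ske cC nn h).
  by apply: zP (dp_prev df n0n) h _; apply: (fresh cC); lia.
- by case: (dpath_new_collider dT (fresh cC) n0n h ske cC).
exact: (sound_tail_arrow sT h).
Qed.

Lemma spread_R4_right : T (c, e) = Some Arrow.
Proof.
have [cC|//] := arrow_circle cb eb ce.
have nn : 0 < n.+1 <= n.+1 by lia.
by case: (no_back_arrows (fresh cC) ske cC nn eb); apply: spread_R4_left.
Qed.

End R4.

(** The new arrowhead of R4 at [c] follows from R2 alone, since [a] points
    to [c] and has an arrowhead coming from [b]. *)
Lemma step14_spread Q : fci_step14 sepset P Q -> extends Q T -> arrows_spread Q.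
Proof.
case=> {Q}.
- move=> a b c ab cb ac QT u v e; rewrite orientE; case: ifP => [|_].
    case/andP=> /eqP-> /eqP-> _ ec be; apply: spread_R1 ab ac _ ec be.
    apply: (tail_dir sT); apply: QT => //; rewrite orientE !eqxx.
    by have /negPf := sk_neq (mark_sk sP cb) => ->.
  by case: ifP => // _; apply: zP.
- move=> a b c hyp ac QT u v e; rewrite set_markE; case: ifP => [|_]; last exact: zP.
  case/andP=> /eqP-> /eqP-> _; apply: spread_R2 hyp _.
  by apply: QT => //; rewrite set_markE !eqxx.
- move=> a b c d ab cb ad cd ac db QT u v e; rewrite set_markE.
  case: ifP => [|_]; last exact: zP.
  case/andP=> /eqP-> /eqP-> _; apply: spread_R3 ab cb ad cd ac _.
  by apply: QT => //; rewrite set_markE !eqxx.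
- move=> x q a b c /discriminating_dpath[f [n [df fx fa fb]]] cb bS QT u v e.
  rewrite orientE; case: ifP => [|_].
    case/andP=> /eqP-> /eqP-> _ ec be; rewrite -fb in be *.
    apply: spread_R4_in ec be => //.
    apply: (tail_dir sT); apply: QT => //; rewrite orientE fb !eqxx.
    by have /negPf := sk_neq (mark_sk sP cb) => ->.
  by case: ifP => // _; apply: zP.
move=> x q a b c /discriminating_dpath[f [n [df fx fa fb]]] cb bS QT u v e.
have n0n : 0 < n <= n by rewrite (dp_pos df) leqnn.
have QE s t : orient (orient P a Arrow Arrow b) b Arrow Arrow c (s, t) =
  if [|| (s == b) && (t == c), (s == c) && (t == b), (s == a) && (t == b)
   | (s == b) && (t == a)] then Some Arrow else P (s, t).
  rewrite !orientE; do 4 (case: ifP => //= _).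
have abT : T (a, b) = Some Arrow by apply: QT => //; rewrite QE !eqxx !orbT.
have cbT : T (c, b) = Some Arrow by apply: QT => //; rewrite QE !eqxx !orbT.
have bcT : T (b, c) = Some Arrow by apply: QT => //; rewrite QE !eqxx.
rewrite QE; case: ifP => [|_]; last exact: zP.
case/or4P => /andP[/eqP-> /eqP->] _ he hne.
- apply: (spread_R2 (b := a)) bcT he hne; right; split.
    by rewrite -fa -fb; exact: (dp_next df n0n).
  by rewrite -fa; exact: (dp_dir df n0n).
- by rewrite -fb in he cbT abT; rewrite -fa in abT; apply: (spread_R4_right df abT cbT he).
- by rewrite -fb in he cbT abT; rewrite -fa in abT *; apply: (spread_R4_left df abT cbT he).
apply: zP he hne; rewrite -fa -fb; exact: (dp_next df n0n).
Qed.

End Step.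

(** For an arrowhead coming from an unshielded collider at [b] with other
    end [d], a missing arrowhead at [e] would let R3 orient [e] into [b], or
    R1 orient the edge between [a] and [e]. *)
Lemma initial_spread : extends (initial_pgraph G K sepset) T ->
  arrows_spread (initial_pgraph G K sepset).
Proof.
move=> iT a b e ab eb ae; have skab := mark_sk (initial_sound hG hsep) ab.
have skae : sk a e.
  by apply: terminal_adj eb ae; apply: iT ab.
have skeb := mark_sk sT eb.
move: (ab); rewrite initialE skab.
case: ifP => aK.
  have [eK|eK] := boolP (e \in K).
    have : T (e, b) = Some Arrow by apply: iT => //; rewrite initialE skeb eK.
    by rewrite eb.
  by move=> _; apply: iT => //; rewrite initialE skae aK.
case: ifP => bK //; case: ifP => // /existsP[d /and4P[bd ad nad bS]] _.
have skdb : sk d b by rewrite (sk_sym hG).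
have abT : T (a, b) = Some Arrow by apply: iT.
have dbT : T (d, b) = Some Arrow.
  apply: iT => //; rewrite initialE skdb; case: ifP => // _; rewrite bK ifT //.
  apply/existsP; exists a; rewrite /shows_collider (sk_sym hG) skab eq_sym ad.
  by rewrite (sk_sym hG) nad setUC.
have de : d != e by apply/eqP=> h; move: dbT; rewrite h eb.
have [circ|//] := arrow_circle abT eb ae.
have [dC|dA] := arrow_circle dbT eb de.
  have nadj : nonadj T a d by rewrite (nonadjE sT) ad.
  by case: (hT (R3 sepset abT dbT circ dC nadj eb)).
by have := terminal_adj dA circ; rewrite eq_sym ad (sk_sym hG) (negPf nad) => /(_ isT).
Qed.

End Arrowheads.

(** * Tails pass along strongly connected components *)
Section Tails.
Variables (V : finType) (G : dmg V) (K : {set V}).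
Hypothesis hG : jci123 G K.
Variable sepset : {set V} -> {set V}.
Hypothesis hsep : valid_sepset K (IM_sigma G) sepset.
Implicit Types (P Q T F : pgraph V) (u v w a b c d x i j k : V).

Local Notation sk := (fci_adjacent K (IM_sigma G)).
Local Notation an := (an G).

(** Induction along a run with a fixed final graph [T]: the invariant [I]
    may speak of [T], and [R] relates each intermediate graph to [T]. *)
Lemma run_ind (step R : pgraph V -> pgraph V -> Prop) (I : pgraph V -> Prop) T :
  (forall P, R P P) -> (forall P Q S, R P Q -> R Q S -> R P S) ->
  (forall P Q, sound G K P -> step P Q -> sound G K Q /\ R P Q) ->
  (forall P Q, sound G K P -> R P T -> step P Q -> R Q T -> I P -> I Q) ->
  forall P, clos_refl_trans _ step P T -> sound G K P ->
  [/\ sound G K T, R P T & I P -> I T].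
Proof.
move=> Rr Rt Rs hI P run.
elim: {P T run}(clos_rt_rt1n _ _ _ _ run) hI => [S|S S' S'' st _ IH] hI sS.
  by split.
have [sS' SS'] := Rs _ _ sS st; have [sT S'T hT] := IH hI sS'.
have ST : R S S'' by apply: Rt SS' S'T.
by split=> // iS; apply/hT; apply: hI st S'T iS.
Qed.

Lemma sc_circle P i j : sound G K P -> i != j -> j \in sc G i -> P (i, j) = Some Circle.
Proof.
move=> sP ij scj; have [ji ij'] : j \in an i /\ i \in an j.
  by move: scj; rewrite scE => /andP.
case: (sk_mark sP (sk_sc hG ij scj)) => // h.
  by have := sound_arrow sP h; rewrite ji.
by have := sound_arrow sP (sound_tail_arrow sP h); rewrite ij'.
Qed.

(** As for [arrows_spread], the tails of [P] are compared with the terminal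
    graph [T], so that the property can be proved by induction along a run. *)
Definition tails_spread T P := forall k i j,
  P (i, k) = Some Tail -> j \in sc G i -> T (j, k) = Some Tail.

Section FirstStage.
Variable T : pgraph V.
Hypotheses (sT : sound G K T) (hT : forall Q, ~ fci_step14 sepset T Q).

Lemma nonadj_sc a c j : sk a c = false -> a != c -> j \in sc G c ->
  (j \in an a -> False) -> nonadj T a j.
Proof.
move=> nac ac jc nja; rewrite (nonadjE sT); apply/andP; split.
  by apply/eqP=> aj; apply: nja; rewrite aj an_refl.
apply/negP=> aj; suff: sk a c by rewrite nac.
apply: (sk_into_sc hG aj); first by apply/negP.
by rewrite sc_sym.
Qed.

(** In R1 and R4 the node [c] can be replaced by any [j] of its component:
    adjacency passes to [j] because of the arrowhead at [c], and
    non-adjacency because [j] is not an ancestor of [a], respectively [f 0].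
    The rule then applies to [j] in [T]. *)
Lemma step14_tails P Q : sound G K P -> extends P T -> fci_step14 sepset P Q ->
  extends Q T -> tails_spread T P -> tails_spread T Q.
Proof.
move=> sP PT pq QT tP k i j; case: pq QT => {Q}.
- move=> a b c ab cb ac QT; rewrite orientE.
  have bc : sk b c by rewrite (sk_sym hG); apply: mark_sk cb.
  rewrite [(i == b) && _]andbC; case: ifP => // _.
  case: ifP => [/andP[/eqP-> /eqP->] _ jc|_]; last exact: tP.
  have ac' := ac; rewrite (nonadjE sP) in ac'.
  have cbA : P (c, b) <> Some Arrow by rewrite cb.
  have [b_c c_b] := unshielded_child hG sP (mark_sk sP ab) (sound_arrow sP ab) bc ac' cbA.
  have b_j : b \in an j by rewrite (an_sc jc).
  have skjb : sk j b by rewrite (sk_sym hG); exact: (sk_into_sc hG bc c_b jc).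
  have naj : nonadj T a j.
    case/andP: ac' => ac1 /negbTE ac2; apply: (nonadj_sc ac2 ac1 jc) => ja.
    by case/negP: (sound_arrow sP ab); apply: an_trans b_j ja.
  have abT : T (a, b) = Some Arrow by apply: PT.
  case: (sk_mark sT skjb) => // h; first by case: (hT (R1 sepset abT h naj)).
  by have := sound_arrow sT h; rewrite b_j.
- by move=> a b c _ _ _; rewrite set_markE; case: ifP => // _; apply: tP.
- by move=> a b c d _ _ _ _ _ _ _; rewrite set_markE; case: ifP => // _; apply: tP.
- move=> x q a b c /discriminating_dpath[f [n [df fx fa fb]]] cb bS QT.
  rewrite orientE; case: ifP => // _.
  case: ifP => [/andP[/eqP-> /eqP->] _ jc|_]; last exact: tP.
  rewrite -fx -fb in bS *; have [c_b hb _] := dpath_semantics hG hsep sP df.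
  have b_c := hb bS; have b_j : f n.+1 \in an j by rewrite (an_sc jc).
  have c_j : c \in an j by move: jc; rewrite scE => /andP[].
  have skbc : sk (f n.+1) c by rewrite -(sound_adj sP); apply: dp_last df.
  have skbj := sk_into_sc hG skbc c_b jc.
  have skjb : sk j (f n.+1) by rewrite (sk_sym hG).
  have dT := dpath_extends sT sP PT df.
  have one : 0 < 1 <= n by rewrite (dp_pos df).
  have n0j : nonadj T (f 0) j.
    have := dp_nonadj df; rewrite (nonadjE sP) => /andP[f0c /negbTE nf0c].
    apply: (nonadj_sc nf0c f0c jc) => jf0.
    case/negP: (sound_arrow sP (dp_prev df one)).
    have [f1c _] := p_dir_an sP (dp_dir df one).
    by apply: an_trans jf0; rewrite (an_sc jc).
  have fresh m : m <= n.+1 -> f m != j.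
    move=> mn; apply/eqP=> fj.
    have cf : c \in an (f m) by rewrite fj.
    have [m0|m0] := posnP m.
      by move: n0j; rewrite /nonadj -fj m0 eqxx.
    have [hm|hm] := leqP m n.
      have mn' : 0 < m <= n by rewrite m0.
      by have [_] := p_dir_an sP (dp_dir df mn'); rewrite cf.
    have mE : m = n.+1 by lia.
    by move: cf; rewrite mE (negPf c_b).
  case: (sk_mark sT skjb) => // h; last by have := sound_arrow sT h; rewrite b_j.
  have := dpath_new_end sT hT dT fresh (j := 0) (dp_pos df) (leqnn n) n0j.
  rewrite add0n; case=> // m mn.
  by have [t _] := dp_dir df mn; apply: tP t jc.
move=> x q a b c _ _ _ _; rewrite !orientE.
by do 4 (case: ifP => // _); apply: tP.
Qed.

Lemma initial_tails : extends (initial_pgraph G K sepset) T ->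
  tails_spread T (initial_pgraph G K sepset).
Proof.
move=> iT k i j; rewrite initialE; case: ifP => // ik; case: ifP => // iK.
case: ifP => [kK _ ji|_]; last by case: ifP.
have ki : sk k i by rewrite (sk_sym hG).
have [_ ki'] := adjacentP hG k i ki.
have [_ ik'] := context_system hG kK (negbT iK) ki'.
have kj := sk_into_sc hG ki ik' ji.
apply: iT => //; rewrite initialE (sk_sym hG) kj kK; case: ifP => // jK.
by move: iK; rewrite (context_sc hG jK (u := i)) ?jK // sc_sym.
Qed.

End FirstStage.

Section SecondStage.
Variable F : pgraph V.
Hypotheses (sF : sound G K F) (hF : forall Q, ~ fci_step810 F Q)
  (zF : arrows_spread F F).

Definition same_arrows P :=
  extends P F /\ forall e, F e = Some Arrow -> P e = Some Arrow.

Lemma uncovered_final P a p c : sound G K P ->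
  (forall e, F e = Some Arrow -> P e = Some Arrow) ->
  uncovered_possibly_dir P a p c -> uncovered_possibly_dir F a p c.
Proof.
move=> sP FP [up pp lp np]; split=> //.
  apply: sub_path pp => u v /(possibly_dirP hG _ _ sP)[uv nvu].
  by apply/(possibly_dirP hG _ _ sF); split=> // /FP.
by move=> m /np; rewrite (nonadjE sP) (nonadjE sF).
Qed.

(** No node before the end of the path has [c] as an ancestor: this would
    make a later strict step run inside a component. Hence adjacency to [c]
    and to [j] agree for all of them, and the end [c] may be replaced by
    [j]. *)
Lemma uncovered_sc_end a c j s : uncovered_possibly_dir F a (rcons s c) c ->
  c \notin an a -> j \in sc G c -> j != c ->
  uncovered_possibly_dir F a (rcons s j) j /\
  forall m, m <= size s -> nonadj F (nth a (a :: s) m) c ->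
    nonadj F (nth a (a :: s) m) j.
Proof.
move=> pF nca jc njc; have [up pp _ np] := pF.
set v := nth a (a :: s).
have vE x m : m <= size s -> nth a (a :: rcons s x) m = v m.
  by move=> ms; rewrite -rcons_cons nth_rcons /= ltnS ms.
have vS x : nth a (a :: rcons s x) (size s).+1 = x.
  by rewrite -rcons_cons nth_rcons /= ltnn eqxx.
have c_j : c \in an j by move: jc; rewrite scE => /andP[].
have sE x : size (rcons s x) = (size s).+1 by rewrite size_rcons.
have notan m : m <= size s -> c \notin an (v m).
  elim: m => [//|m IH] ms; have nm := IH (ltnW ms); apply/negP=> cm.
  have nmm : nth a (a :: rcons s c) m.+1 \notin an (nth a (a :: rcons s c) m).
    by rewrite !vE ?(ltnW ms) //; apply: contra nm => /(an_trans cm).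
  have b1 : m.+1 <= m.+2 <= size (rcons s c) by rewrite sE; lia.
  have [_ nm2] := uncovered_descends hG sF pF (ltn0Sn m) b1 nmm.
  have b2 : m.+2 <= (size s).+1 <= size (rcons s c) by rewrite sE; lia.
  have [h _] := uncovered_descends hG sF pF (ltn0Sn m.+1) b2 nm2.
  case/negP: nm2; apply: an_trans h _; rewrite vS.
  by move: cm; rewrite -(vE c).
have nej m : m <= size s -> v m != j.
  by move=> ms; apply: contraNneq (notan m ms) => ->.
have back m : m <= size s -> nonadj F (v m) c -> nonadj F (v m) j.
  move=> ms; rewrite !(nonadjE sF) (nej m ms) => /andP[_] /=; apply: contra => mj.
  apply: (sk_into_sc hG mj); last by rewrite sc_sym.
  by apply: contra (notan m ms) => /(an_trans c_j).
split=> //; split; last 1 first.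
- move=> m; rewrite sE => m2; have := np m; rewrite sE => /(_ m2).
  rewrite !(vE _ (m - 2)); [|lia..]; have [ms|ms] := leqP m (size s).
    by rewrite !vE.
  have -> : m = (size s).+1 by lia.
  by rewrite !vS; apply: back; lia.
- rewrite -rcons_cons rcons_uniq; apply/andP; split.
    apply/negP=> /(nthP a)[m ms mj].
    by have := nej m ms; rewrite /v mj eqxx.
  by move: up; rewrite -rcons_cons rcons_uniq => /andP[].
- move: pp; rewrite !rcons_path => /andP[-> /= /(possibly_dirP hG _ _ sF)].
  have lE : last a s = v (size s) by rewrite /v -nth_last; case: (s).
  rewrite lE => -[yc ncy]; apply/(possibly_dirP hG _ _ sF); split.
    exact: (sk_into_sc hG yc (notan _ (leqnn _)) jc).
  move=> jy; have skcy : sk c (v (size s)) by rewrite (sk_sym hG).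
  case: (sk_mark sF skcy) => // h.
    have := zF jy h njc; have scj : c \in sc G j by rewrite sc_sym.
    by rewrite (sc_circle sF njc scj).
  by case/negP: (sound_arrow sF jy); apply: an_trans (sound_tail sF h) c_j.
by rewrite last_rcons.
Qed.

(** Whichever rule puts the tail on the edge from [a] to [c], its premises
    hold in [F] with [j] in place of [c]; since [F] is terminal, the mark at
    [a] on the edge to [j] is not a circle. *)
Lemma step810_tails P Q : sound G K P -> same_arrows P -> fci_step810 P Q ->
  same_arrows Q -> tails_spread F P -> tails_spread F Q.
Proof.
move=> sP [PF FP] pq [QF _] tP k i j.
suff key a c : p_circ_arrow P a c -> F (c, a) = Some Tail -> j \in sc G c -> j != c ->
    (p_circ_arrow F a j -> exists F', fci_step810 F F') -> F (j, a) = Some Tail.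
  have dirF u v : p_dir P u v -> p_dir F u v by case=> t h; split; apply: PF.
  have dirj u v : p_dir P u v -> j \in sc G v -> p_dir F u j.
    by case=> t _ jv; apply: (tail_dir sF); apply: tP t jv.
  have tl a c : Q = orient P a Tail Arrow c -> a != c -> F (c, a) = Some Tail.
    move=> QE ac; apply: QF => //; rewrite QE orientE !eqxx [c == a]eq_sym.
    by rewrite (negPf ac).
  have main a c : p_circ_arrow P a c -> Q = orient P a Tail Arrow c ->
      (j \in sc G c -> j != c -> p_circ_arrow F a j -> exists F', fci_step810 F F') ->
      Q (i, k) = Some Tail -> j \in sc G i -> F (j, k) = Some Tail.
    move=> ac QE rule; have [_ acA] := ac.
    have ta := tl a c QE (sk_neq (mark_sk sP acA)).
    rewrite QE orientE; case: ifP => // _; case: ifP => [/andP[/eqP-> /eqP->] _ jc|_].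
      have [->|njc] := eqVneq j c; first exact: ta.
      by apply: (key a c) => //; apply: rule.
    exact: tP.
  case: pq main {tl QF} => {Q}.
  - move=> a b c ab bc ac main; apply: (main a c) => // jc njc acj.
    by eexists; apply: R8a (dirF _ _ ab) (dirj _ _ bc jc) acj.
  - move=> a b p c ac pd bc main; apply: (main a c) => // jc njc acj.
    have pF := uncovered_final sP FP pd.
    have [_ acA] := ac.
    have lc : last a (b :: p) = c by case: pd.
    move: bc; rewrite (nonadjE sP) -(nonadjE sF) => bc.
    case/lastP: p => [|s c'] in pd pF lc.
      by move: bc; rewrite /nonadj -lc eqxx.
    have c'E : c' = c by move: lc; rewrite /= last_rcons.
    rewrite c'E -rcons_cons in pF.
    have [pj back] := uncovered_sc_end pF (sound_arrow sP acA) jc njc.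
    by eexists; apply: R9 acj pj _; apply: (back 1).
  move=> a b c d m1 p1 m2 p2 ac bc dc pd1 pd2 m12 main.
  apply: (main a c) => // jc njc acj.
  eexists; apply: R10 acj (dirj _ _ bc jc) (dirj _ _ dc jc)
    (uncovered_final sP FP pd1) (uncovered_final sP FP pd2) _.
  by rewrite (nonadjE sF) -(nonadjE sP).
move=> ac ta jc njc rule; have [_ /PF acA] := ac.
have {}acA : F (a, c) = Some Arrow by apply: acA.
have cj : c != j by rewrite eq_sym.
have scj : c \in sc G j by rewrite sc_sym.
have skac := mark_sk sF acA.
have skaj := sk_into_sc hG skac (sound_arrow sF acA) jc.
have ajA : F (a, j) = Some Arrow.
  by apply: zF acA (sc_circle sF njc scj) _; apply: sk_neq skaj.
have skja : sk j a by rewrite (sk_sym hG).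
case: (sk_mark sF skja) => // h.
  have [F' st] : exists F', fci_step810 F F' by apply: rule; split.
  by case: (hF st).
case/negP: (sound_arrow sF h); rewrite (an_sc jc); exact: (sound_tail sF ta).
Qed.

End SecondStage.
End Tails.

(** * Marks within a strongly connected component *)

Theorem proposition12 (V : finType) (G : dmg V) (K : {set V})
    (hG : jci123 G K)
    (P : pgraph V) (hP : fci_jci_output K (IM_sigma G) P)
    (i j : V) (hij : i != j) (hsc : j \in sc G i) :
  p_circ_circ P i j /\
  (forall k : V, k != i -> k != j ->
     [/\ p_dir P k i <-> p_dir P k j,
         p_bidir P k i <-> p_bidir P k j
       & p_circ_arrow P k i <-> p_circ_arrow P k j]).
Proof.
have [sepset hsep [T [run1 hT] [run2 hP']]] := hP.
have sI := initial_sound hG hsep.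
have [sT IT _] := run_ind (I := fun=> True) (@extends_refl V) (@extends_trans V)
  (step14_sound hG hsep) (fun _ _ _ _ _ _ _ => I) run1 sI.
have [_ _ /(_ (initial_spread hG hsep sT hT IT)) zT] := run_ind
  (@extends_refl V) (@extends_trans V) (step14_sound hG hsep)
  (fun P Q sP PT st QT zP => step14_spread hG sT hT sP PT zP st QT) run1 sI.
have [_ _ /(_ (initial_tails hG IT)) tT] := run_ind
  (@extends_refl V) (@extends_trans V) (step14_sound hG hsep)
  (fun P Q sP PT st QT tP => step14_tails hG hsep sT hT sP PT st QT tP) run1 sI.
(* the tail rules create no arrowheads: arrowheads pass in both directions *)
pose R P Q : Prop := extends P Q /\
  forall e : V * V, Q e = Some Arrow -> P e = Some Arrow.
have Rr Q : R Q Q by split.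
have Rt Q1 Q2 Q3 : R Q1 Q2 -> R Q2 Q3 -> R Q1 Q3.
  by case=> e1 a1 [e2 a2]; split; [apply: extends_trans e1 e2|move=> e /a2/a1].
have Rs Q1 Q2 : sound G K Q1 -> fci_step810 Q1 Q2 -> sound G K Q2 /\ R Q1 Q2.
  by move=> s1 /(step810_sound hG s1)[].
have [sP [TP PT] _] := run_ind (I := fun=> True) Rr Rt Rs
  (fun _ _ _ _ _ _ _ => I) run2 sT.
have zP : arrows_spread P P.
  move=> a b e /PT ab eb ae; apply: (TP) => //; apply: zT ab _ ae.
  case: (sk_mark sT (mark_sk sP eb)) => // h;
    have h' : P (e, b) <> Some Circle by rewrite (TP _ _ _ _ h).
    by case: h'.
  by case: h'.
have tTP : tails_spread G P T by move=> k u v t uv; apply: (TP) => //; apply: tT t uv.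
have [_ _ /(_ tTP) tP] := run_ind Rr Rt Rs
  (fun Q1 Q2 s1 r1 st r2 t => step810_tails hG sP hP' zP s1 r1 st r2 t) run2 sT.
have circ := sc_circle hG sP.
have one u v k : u != v -> v \in sc G u -> k != u -> k != v ->
  [/\ p_dir P k u -> p_dir P k v, p_bidir P k u -> p_bidir P k v
    & p_circ_arrow P k u -> p_circ_arrow P k v].
  move=> uv scv ku kv; have vu : v != u by rewrite eq_sym.
  have scu : u \in sc G v by rewrite sc_sym.
  have arr : P (k, u) = Some Arrow -> P (k, v) = Some Arrow.
    by move=> h; apply: zP h (circ _ _ vu scu) kv.
  split=> -[h /arr hA]; split=> //; have skvk : fci_adjacent K (IM_sigma G) v k.
  - by rewrite (sk_sym hG); apply: mark_sk hA.
  - exact: tP h scv.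
  - by rewrite (sk_sym hG); apply: mark_sk hA.
  - case: (sk_mark sP skvk) => // h'.
      by have := zP _ _ _ h h' uv; rewrite (circ _ _ uv scv).
    by have := tP _ _ _ h' scu; rewrite h.
  - by rewrite (sk_sym hG); apply: mark_sk hA.
  case: (sk_mark sP skvk) => // h'.
    by have := zP _ _ _ h' h vu; rewrite (circ _ _ vu scu).
  by have := tP _ _ _ h' scu; rewrite h.
have hji : j != i by rewrite eq_sym.
have hsc' : i \in sc G j by rewrite sc_sym.
split; first by split; apply: circ.
move=> k ki kj; have [a1 a2 a3] := one i j k hij hsc ki kj.
have [b1 b2 b3] := one j i k hji hsc' kj ki.
by split; split.
Qed.
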